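(* Let $M$ be a smooth manifold and let $\varpi\in \Omega^{1,1}_{\Delta_M}(M\mid M)$ be a contrast bi-form such that $(M,g^\varpi,\nabla^\varpi)$ is a SMAT, i.e. $\nabla^\varpi$ is torsion-free. Then there exists $S\in\Omega^{0,1}_{\Delta_M}(M\mid M)$ with $S_{\restriction\Delta_M}=0$ such that $\varpi$ is statistically equivalent to $\mathrm d^L S$.
   Context: $M$ is a finite-dimensional, paracompact, connected smooth manifold; $\pi_L,\pi_R\colon M\times M\to M$ are the projections $\pi_L(m,n)=m$, $\pi_R(m,n)=n$; $\iota\colon M\to M\times M$, $\iota(m)=(m,m)$, is the diagonal embedding with image $\Delta_M$. For $X\in\mathfrak X(M)$, the lifts $X^L,X^R\in\mathfrak X(M\times M)$ are $X^L=(X,0)$ and $X^R=(0,X)$. A $(p,q)$-bi-form is a smooth section of the vector bundle $\bigwedge^p\pi_L^*T^*M\otimes\bigwedge^q\pi_R^*T^*M\to M\times M$, whose fibre at $(m,n)$ is $\bigwedge^pT^*_mM\otimes\bigwedge^qT^*_nM$. $\Omega^{p,q}_{\Delta_M}(M\mid M)$ denotes the local $(p,q)$-bi-forms, i.e. those defined on some open neighbourhood of $\Delta_M$ in $M\times M$. For vector fields $X_i,Y_j$ on $M$, $\varpi(X_1,\dots,X_p\mid Y_1,\dots,Y_q)$ is the function $(m,n)\mapsto\varpi_{(m,n)}((X_1)_m,\dots,(X_p)_m\mid (Y_1)_n,\dots,(Y_q)_n)$. The diagonal restriction $\varpi_{\restriction\Delta_M}$ is the $(p+q)$-covariant tensor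 on $M$ with $\varpi_{\restriction\Delta_M}(Z_1,\dots,Z_{p+q})=\iota^*\big(\varpi(Z_1,\dots,Z_p\mid Z_{p+1},\dots,Z_{p+q})\big)$. The left exterior derivative of $S\in\Omega^{0,1}_{\Delta_M}(M\mid M)$ is $\mathrm d^LS\in\Omega^{1,1}_{\Delta_M}(M\mid M)$, $(\mathrm d^LS)(X\mid Y)=\mathcal L_{X^L}(S(\mid Y))$. The left Lie derivative of a $(1,1)$-bi-form is $(\mathcal L_{Z\mid}\varpi)(X\mid Y)=\mathcal L_{Z^L}(\varpi(X\mid Y))-\varpi([Z,X]\mid Y)$. A local bi-form $\varpi\in\Omega^{1,1}_{\Delta_M}(M\mid M)$ is a contrast bi-form if $g^\varpi:=\varpi_{\restriction\Delta_M}$ is a pseudo-Riemannian metric on $M$. It then induces an affine connection $\nabla^\varpi$ on $M$ by $g^\varpi(\nabla^\varpi_ZX,Y)=(\mathcal L_{Z\mid}\varpi)_{\restriction\Delta_M}(X,Y)+g^\varpi([Z,X],Y)$ for all $X,Y,Z\in\mathfrak X(M)$. A triple $(M,g,\nabla)$ of a pseudo-Riemannian metric and an affine connection is a SMAT (statistical manifold admitting torsion) if $\nabla$ is torsion-free. Two contrast bi-forms $\varpi_1,\varpi_2$ are statistically equivalent if $g^{\varpi_1}=g^{\varpi_2}$ and $\nabla^{\varpi_1}=\nabla^{\varpi_2}$ (in particular, statistical equivalence to $\mathrm d^LS$ includes that $\mathrm d^LS$ is a contrast bi-form). *)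

(* Defs.v *)
From HB Require Import structures.
From mathcomp Require Import all_boot all_order all_algebra.
From mathcomp Require Import all_classical all_reals all_analysis.
Import Order.TTheory GRing.Theory Num.Theory.
Import numFieldNormedType.Exports.

Set Implicit Arguments.
Unset Strict Implicit.
Unset Printing Implicit Defensive.

Local Open Scope classical_set_scope.
Local Open Scope ring_scope.

Section NearEqDifferentiable.
Variables (R : realType) (V W : normedModType R).

Lemma near0_differentiable (h : V -> W) (x : V) :
  (\near x, h x = 0) -> differentiable h x.
Proof.
move=> h0.
have h0' : \forall y \near 0, h (y + x) = 0.
  move: (h0); rewrite (near_shift (0 : V)).
  by apply: filterS => y /=; rewrite subr0.
have hs : h \o shift x = cst (h x) + (\0 : V -> W) +o_ 0 id.
  apply/eqaddoP => _/posnumP[e]; near=> y.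
  have -> : (h \o shift x - (cst (h x) + (\0 : V -> W))) y = 0.
    rewrite !fctE /= (nbhs_singleton h0) addr0 subr0.
    by near: y.
  by rewrite normr0 mulr_ge0.
have c0 : continuous (\0 : V -> W) by exact: cst_continuous.
apply/diff_locallyP; have -> := @diff_unique _ _ _ h (\0 : {linear V -> W}) x c0 hs.
by split.
Unshelve. all: by end_near. Qed.

Lemma near_eq_differentiable (f g : V -> W) (x : V) :
  (\near x, f x = g x) -> differentiable f x -> differentiable g x.
Proof.
move=> fg fx; have -> : g = f + (g - f) by rewrite addrC subrK.
apply: differentiableD => //; apply: near0_differentiable.
by apply: filterS fg => y fgy; rewrite !fctE fgy subrr.
Qed.

End NearEqDifferentiable.

Section Smooth.
Variables (R : realType) (V W : normedModType R).

(* Meant for [A] open and [V] finite-dimensional: there, the differential of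
   [f] is C^k iff all the directional derivatives ['D_v f] are. *)
Fixpoint Ck (k : nat) (A : set V) (f : V -> W) : Prop :=
  if k is k'.+1 then
    (forall x, A x -> differentiable f x) /\
    (forall v, Ck k' A (fun x => 'D_v f x))
  else forall x, A x -> {for x, continuous f}.

Definition smooth_on (A : set V) (f : V -> W) : Prop := forall k, Ck k A f.

Lemma eq_Ck k (A : set V) (f g : V -> W) :
  open A -> (forall x, A x -> f x = g x) -> Ck k A f -> Ck k A g.
Proof.
move=> oA; elim: k f g => [|k IHk] f g fg /=.
  move=> fc x Ax; rewrite /prop_for /continuous_at -fg//.
  apply: cvg_trans (fc x Ax); apply: near_eq_cvg.
  by near=> y; apply: fg; near: y; exact: open_nbhs_nbhs.
have fgA x : A x -> \near x, f x = g x.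
  by move=> Ax; near=> y; apply: fg; near: y; exact: open_nbhs_nbhs.
move=> [fd fk]; split.
  by move=> x Ax; apply: near_eq_differentiable (fgA x Ax) (fd x Ax).
move=> v; apply: IHk (fk v) => x Ax.
exact/near_eq_derive/fgA.
Unshelve. all: by end_near. Qed.

End Smooth.

Lemma openX (T T' : topologicalType) (A : set T) (B : set T') :
  open A -> open B -> open (A `*` B).
Proof.
rewrite !openE => oA oB [x y] [Ax By].
by exists (A, B) => //=; split; [exact: oA|exact: oB].
Qed.

Lemma smooth_on_prod (R : realType) (V V' W W' : normedModType R)
    (A : set V) (B : set V') (f : V -> W) (g : V' -> W') :
  open A -> open B -> smooth_on A f -> smooth_on B g ->
  smooth_on (A `*` B) (fun p : V * V' => (f p.1, g p.2)).
Proof.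
move=> oA oB sf sg k; move: (sf k) (sg k) => {sf sg}.
elim: k f g => [|k IHk] f g /=.
  move=> fc gc [x y] [/= Ax By].
  apply: (@cvg_pair _ _ _ _ (nbhs (f x)) (nbhs (g y))) => /=.
    by apply: (cvg_comp _ _ cvg_fst); exact: fc.
  by apply: (cvg_comp _ _ cvg_snd); exact: gc.
move=> [fd fk] [gd gk].
have dfst (p : V * V') : differentiable (fst : V * V' -> V) p.
  apply: linear_differentiable => ?; exact: cvg_fst.
have dsnd (p : V * V') : differentiable (snd : V * V' -> V') p.
  apply: linear_differentiable => ?; exact: cvg_snd.
have dpair p : (A `*` B) p ->
    differentiable (fun p : V * V' => (f p.1, g p.2)) p.
  move=> [Ap Bp]; apply: differentiable_pair.
    by apply: (@differentiable_comp _ _ _ _ fst f) => //; exact: fd.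
  by apply: (@differentiable_comp _ _ _ _ snd g) => //; exact: gd.
split=> // -[u v].
apply: eq_Ck (IHk _ _ (fk u) (gk v)); first exact: openX.
move=> p Dp; have [Ap Bp] := Dp.
rewrite [RHS]deriveE; last exact: dpair.
rewrite diff_pair/=; last 2 first.
- by apply: (@differentiable_comp _ _ _ _ fst f) => //; exact: fd.
- by apply: (@differentiable_comp _ _ _ _ snd g) => //; exact: gd.
rewrite (@diff_comp _ _ _ _ fst f)//; last exact: fd.
rewrite (@diff_comp _ _ _ _ snd g)//; last exact: gd.
rewrite /= !diff_lin/=; [|by move=> ?; exact: cvg_snd|by move=> ?; exact: cvg_fst].
by rewrite !deriveE//; [exact: gd|exact: fd].
Qed.

Section Manifold.
Variables (R : realType).

Record chart (T : topologicalType) (V : normedModType R) := Chart {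
  cdom : set T;
  ccod : set V;
  cmap :> T -> V;
  cinv : V -> T;
  open_cdom : open cdom;
  open_ccod : open ccod;
  cmap_cod : forall p, cdom p -> ccod (cmap p);
  cinv_dom : forall x, ccod x -> cdom (cinv x);
  cmapK : forall p, cdom p -> cinv (cmap p) = p;
  cinvK : forall x, ccod x -> cmap (cinv x) = x;
  cmap_continuous : forall p, cdom p -> {for p, continuous cmap};
  cinv_continuous : forall x, ccod x -> {for x, continuous cinv} }.

(* A topological space with a smooth atlas modelled on [V].  The preferred
   chart [chart_at p] identifies the tangent space at [p] with [V]: a tangent
   vector at [p] is represented by its components in [chart_at p].  Separation,
   paracompactness and connectedness are not part of the structure. *)
Record manifold (V : normedModType R) := Manifold {
  carrier :> topologicalType;
  atlas : set (chart carrier V);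
  chart_at : carrier -> chart carrier V;
  chart_at_atlas : forall p, atlas (chart_at p);
  chart_at_dom : forall p, cdom (chart_at p) p;
  atlas_smooth : forall c d, atlas c -> atlas d ->
    smooth_on (ccod c `&` cinv c @^-1` cdom d) (d \o cinv c) }.
Arguments atlas {V} _.
Arguments chart_at {V m}.

Definition paracompact (T : topologicalType) : Prop :=
  forall F : set (set T), (forall A, F A -> open A) -> \bigcup_(A in F) A = setT ->
  exists G : set (set T),
    [/\ (forall B, G B -> open B), \bigcup_(B in G) B = setT,
        (forall B, G B -> exists2 A, F A & B `<=` A) &
        (forall p : T, exists2 N, nbhs p N &
           finite_set [set B | G B /\ B `&` N !=set0])].

Lemma open_chart_preimage (T : topologicalType) (V : normedModType R)
  (c : chart T V) (A : set T) : open A -> open (ccod c `&` cinv c @^-1` A).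
Proof.
move=> oA; rewrite openE => x [cx Ax]; apply: filterI.
  by apply: open_nbhs_nbhs; split => //; exact: open_ccod.
by apply: (cinv_continuous cx); apply: open_nbhs_nbhs.
Qed.

Section ProductManifold.
Variables (V V' : normedModType R) (M : manifold V) (N : manifold V').

Program Definition prod_chart (c : chart M V) (d : chart N V') :
    chart (M * N)%type (V * V')%type :=
  @Chart _ _ (cdom c `*` cdom d) (ccod c `*` ccod d)
    (fun p => (c p.1, d p.2)) (fun x => (cinv c x.1, cinv d x.2))
    _ _ _ _ _ _ _ _.
Next Obligation. by move=> c d; apply: openX; exact: open_cdom. Qed.
Next Obligation. by move=> c d; apply: openX; exact: open_ccod. Qed.
Next Obligation. by move=> c d p [? ?]; split; exact: cmap_cod. Qed.
Next Obligation. by move=> c d p [? ?]; split; exact: cinv_dom. Qed.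
Next Obligation. by move=> c d [p q] [? ?]; rewrite /= !cmapK. Qed.
Next Obligation. by move=> c d [p q] [? ?]; rewrite /= !cinvK. Qed.
Next Obligation.
move=> c d [p q] [/= cp dq].
apply: (@cvg_pair _ _ _ _ (nbhs (c p)) (nbhs (d q))) => /=.
  by apply: (cvg_comp _ _ cvg_fst); exact: cmap_continuous.
by apply: (cvg_comp _ _ cvg_snd); exact: cmap_continuous.
Qed.
Next Obligation.
move=> c d [p q] [/= cp dq].
apply: (@cvg_pair _ _ _ _ (nbhs (cinv c p)) (nbhs (cinv d q))) => /=.
  by apply: (cvg_comp _ _ cvg_fst); exact: cinv_continuous.
by apply: (cvg_comp _ _ cvg_snd); exact: cinv_continuous.
Qed.

Definition prod_atlas : set (chart (M * N)%type (V * V')%type) :=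
  [set e | exists c d, [/\ atlas M c, atlas N d & e = prod_chart c d]].

Program Definition prod_manifold : manifold (V * V')%type :=
  @Manifold _ (M * N)%type prod_atlas
    (fun p => prod_chart (chart_at p.1) (chart_at p.2)) _ _ _.
Next Obligation.
by move=> [p q]; exists (chart_at p), (chart_at q); split => //; exact: chart_at_atlas.
Qed.
Next Obligation. by move=> [p q]; split; exact: chart_at_dom. Qed.
Next Obligation.
move=> _ _ [c [d [Mc Nd ->]]] [c' [d' [Mc' Nd' ->]]] /=.
have := smooth_on_prod (open_chart_preimage c (open_cdom c'))
  (open_chart_preimage d (open_cdom d'))
  (atlas_smooth Mc Mc') (atlas_smooth Nd Nd').
congr (smooth_on _ _).
by apply/seteqP; split=> [[x y] [[? ?] [? ?]]|[x y] [[? ?] [? ?]]].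
Qed.

End ProductManifold.

Section Calculus.
Variables (V : normedModType R) (M : manifold V).

Definition smooth_fun (W : normedModType R) (A : set M) (f : M -> W) : Prop :=
  forall c, atlas M c -> smooth_on (ccod c `&` cinv c @^-1` A) (f \o cinv c).

(* Derivative of [f] along the tangent vector at [p] represented by [v]. *)
Definition tderiv (W : normedModType R) (p : M) (v : V) (f : M -> W) : W :=
  'D_v (f \o cinv (chart_at p)) (chart_at p p).

(* Components, in the chart [c], of the tangent vector at [p] represented
   by [v]. *)
Definition coords (c : chart M V) (p : M) (v : V) : V := tderiv p v c.

(* The tangent vector at [p] whose components in the chart [c] are [u]. *)
Definition frame (c : chart M V) (p : M) (u : V) : V :=
  'D_u (chart_at p \o cinv c) (c p).

Definition smooth_field (X : M -> V) : Prop :=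
  forall c, atlas M c -> smooth_fun (cdom c) (fun p => coords c p (X p)).

Definition lie (W : normedModType R) (X : M -> V) (f : M -> W) : M -> W :=
  fun p => tderiv p (X p) f.

(* [X, Y]^i = X^j d_j Y^i - Y^j d_j X^i, in the chart [chart_at p]. *)
Definition bracket (X Y : M -> V) : M -> V := fun p =>
  tderiv p (X p) (fun q => coords (chart_at p) q (Y q)) -
  tderiv p (Y p) (fun q => coords (chart_at p) q (X q)).

Definition bilinear2 (V1 V2 : normedModType R) (b : V1 -> V2 -> R) : Prop :=
  (forall v, scalar (b v)) /\ (forall w, scalar (b^~ w)).

Definition pseudo_riemannian (g : M -> V -> V -> R) : Prop :=
  [/\ forall p, bilinear2 (g p),
      forall p v w, g p v w = g p w v,
      forall p v, (forall w, g p v w = 0) -> v = 0 &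
      forall c u w, atlas M c ->
        smooth_fun (cdom c) (fun p => g p (frame c p u) (frame c p w))].

(* [nabla Z X] is the covariant derivative of [X] along [Z]; only its values on
   smooth vector fields are meaningful. *)
Definition affine_connection (nabla : (M -> V) -> (M -> V) -> M -> V) : Prop :=
  [/\ forall Z X, smooth_field Z -> smooth_field X -> smooth_field (nabla Z X),
      forall (f : M -> R) Z Z' X, smooth_fun setT f -> smooth_field Z -> smooth_field Z' ->
        smooth_field X ->
        nabla (fun p => f p *: Z p + Z' p) X =
        (fun p => f p *: nabla Z X p + nabla Z' X p),
      forall Z X X', smooth_field Z -> smooth_field X -> smooth_field X' ->
        nabla Z (fun p => X p + X' p) = (fun p => nabla Z X p + nabla Z X' p) &
      forall (f : M -> R) Z X, smooth_fun setT f -> smooth_field Z ->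
        smooth_field X ->
        nabla Z (fun p => f p *: X p) =
        (fun p => lie Z f p *: X p + f p *: nabla Z X p)].

Definition torsion_free (nabla : (M -> V) -> (M -> V) -> M -> V) : Prop :=
  forall X Y, smooth_field X -> smooth_field Y ->
  forall p, nabla X Y p - nabla Y X p = bracket X Y p.

Definition SMAT (g : M -> V -> V -> R) nabla : Prop :=
  [/\ pseudo_riemannian g, affine_connection nabla & torsion_free nabla].

End Calculus.

Section BiForms.
Variables (V : normedModType R) (M : manifold V).
Local Notation MM := (prod_manifold M M).

(* Local bi-forms are represented by total functions, whose values matter only
   near the diagonal. *)
Definition biform11 := MM -> V -> V -> R.
Definition biform01 := MM -> V -> R.

Definition eval11 (w : biform11) (X Y : M -> V) : MM -> R :=
  fun p => w p (X p.1) (Y p.2).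
Definition eval01 (S : biform01) (Y : M -> V) : MM -> R :=
  fun p => S p (Y p.2).

Definition diag_nbhd (U : set MM) : Prop := open U /\ forall m : M, U (m, m).

(* Smoothness of a section is smoothness of its components in the local frames
   given by the charts. *)
Definition local_biform11 (w : biform11) : Prop :=
  exists U : set MM,
    [/\ diag_nbhd U, forall p, U p -> bilinear2 (w p) &
        forall c d u v, atlas M c -> atlas M d ->
          smooth_fun (U `&` (cdom c `*` cdom d))
            (fun p : MM => w p (frame c p.1 u) (frame d p.2 v))].

Definition local_biform01 (S : biform01) : Prop :=
  exists U : set MM,
    [/\ diag_nbhd U, forall p, U p -> scalar (S p) &
        forall d v, atlas M d ->
          smooth_fun (U `&` (setT `*` cdom d))
            (fun p : MM => S p (frame d p.2 v))].

Definition diag11 (w : biform11) : M -> V -> V -> R := fun m => w (m, m).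
Definition diag01 (S : biform01) : M -> V -> R := fun m => S (m, m).

Definition liftL (X : M -> V) : MM -> V * V := fun p => (X p.1, 0).

Definition dL (S : biform01) : biform11 :=
  fun p v w => tderiv p.1 v (fun m => S (m, p.2) w).

Lemma lie_liftL (X : M -> V) (f : MM -> R) (p : MM) :
  lie (liftL X) f p = tderiv p.1 (X p.1) (fun m => f (m, p.2)).
Proof.
rewrite /lie /tderiv /derive /=; set F := (X in lim (X @ _)).
set G := (X in _ = lim (X @ _)); suff -> : F = G by [].
rewrite {}/F {}/G; apply/funext => h /=.
by rewrite scaler0 add0r !cmapK//; exact: chart_at_dom.
Qed.

Lemma eval_dL (S : biform01) (X Y : M -> V) (p : MM) :
  eval11 (dL S) X Y p = lie (liftL X) (eval01 S Y) p.
Proof. by rewrite lie_liftL. Qed.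

(* [lieL Z w X Y] is (L_{Z|} w)(X | Y). *)
Definition lieL (Z : M -> V) (w : biform11) (X Y : M -> V) : MM -> R :=
  fun p => lie (liftL Z) (eval11 w X Y) p - eval11 w (bracket Z X) Y p.

Definition metric (w : biform11) : M -> V -> V -> R := diag11 w.

Definition contrast (w : biform11) : Prop :=
  local_biform11 w /\ pseudo_riemannian (metric w).

(* The vector at [m] determined by the defining identity; the default value [0]
   is irrelevant when [w] is a contrast bi-form. *)
Definition conn (w : biform11) : (M -> V) -> (M -> V) -> M -> V :=
  fun Z X m => xget 0 [set v | forall Y, smooth_field Y ->
    metric w m v (Y m) =
    lieL Z w X Y (m, m) + metric w m (bracket Z X m) (Y m)].

Definition stat_equiv (w1 w2 : biform11) : Prop :=
  [/\ contrast w1, contrast w2, metric w1 = metric w2 &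
      forall Z X, smooth_field Z -> smooth_field X -> conn w1 Z X = conn w2 Z X].

End BiForms.
End Manifold.

(* Main.v *)
Require Import Defs.
From HB Require Import structures.
From mathcomp Require Import all_boot all_order all_algebra.
From mathcomp Require Import all_classical all_reals all_analysis.
From mathcomp Require Import ring.
Import Order.TTheory GRing.Theory Num.Theory.
Import numFieldNormedType.Exports.
Local Open Scope classical_set_scope.
Local Open Scope ring_scope.

Set Implicit Arguments.
Unset Strict Implicit.
Unset Printing Implicit Defensive.

(** In a chart [c], [w(., y)] is a covector field in the first variable, and the
    trapezoidal rule for its integral along the segment from [y] to [x],
      [1/2 sum_j (c x - c y)_j (w(x, y)(e_j | Y) + w(y, y)(e_j | Y))],
    is a local potential: it vanishes on the diagonal, where its first derivative
    in [x] is [g] and its second derivative is the symmetrization of the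
    Christoffel symbols [d_k w_ij] of the connection, which are already symmetric
    in [k, i] because there is no torsion.  The local potentials are glued with a
    partition of unity in the second variable [y] only: the [x]-derivatives do
    not see it, so on the diagonal they are averages of equal numbers. *)

(** * Calculus of C^k functions on normed spaces *)

(** The metric and the connection of a contrast bi-form depend only on its values and first left
    derivatives on the diagonal, so S matters only through its second-order jet in x at x = y. For
    fixed y and Y, a = w(., y)(. | Y) is a 1-form in x. If it were closed, a local primitive
    vanishing at y would recover w itself. It is guaranteed to be closed only at y, where da(Z, X) =
    g(nabla_Z X - nabla_X Z - [Z, X], Y) vanishes by the absence of torsion, and this is enough for
    agreement to second order: the left derivative on the diagonal is reproduced up to -da(Z, X)/2.
    The trapezoidal rule has the same second-order jet at y as the line integral, while its
    smoothness and derivatives need only rules for sums and products, with no differentiation under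
    an integral sign. *)

Section CkCalculus.
Variables (R : realType).
Implicit Types (V W : normedModType R).

Definition linear_map V W (f : V -> W) (lf : linear f) : {linear V -> W} :=
  HB.pack_for {linear V -> W} f (GRing.isLinear.Build _ _ _ _ f lf).

Lemma Ck_subset V W k (A B : set V) (f : V -> W) :
  B `<=` A -> Ck k A f -> Ck k B f.
Proof.
move=> BA; elim: k f => [|k IHk] f /=; first by move=> fc x /BA; exact: fc.
by move=> [fd fk]; split=> [x /BA|v]; [exact: fd|exact: IHk].
Qed.

(** [Ck] only imposes conditions at the points of [A] on the totally defined functions ['D_v f], so
    it can be tested on singletons. This makes smoothness a local property. *)
Lemma Ck_pointwise V W k (A : set V) (f : V -> W) :
  (forall x, A x -> Ck k [set x] f) -> Ck k A f.
Proof.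
elim: k f => [|k IHk] f /= fA; first by move=> x Ax; exact: (fA x Ax).
split=> [x Ax|v]; first exact: (fA x Ax).1.
by apply: IHk => x Ax; exact: (fA x Ax).2.
Qed.

Lemma Ck_local V W k (A : set V) (f : V -> W) :
  (forall x, A x -> exists2 B, B x & Ck k B f) -> Ck k A f.
Proof.
move=> fA; apply: Ck_pointwise => x /fA[B Bx].
by apply: Ck_subset => _ ->.
Qed.

Lemma Ck_pred V W k (A : set V) (f : V -> W) : Ck k.+1 A f -> Ck k A f.
Proof.
elim: k f => [|k IHk] f /= [fd fk].
  by move=> x Ax; exact/differentiable_continuous/fd.
by split => // v; exact/IHk/fk.
Qed.

Lemma Ck_cst V W k (A : set V) (a : W) : Ck k A (cst a).
Proof.
elim: k a => [|k IHk] a /=; first by move=> x _; exact: cst_continuous.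
split=> [x _|v]; first exact: differentiable_cst.
by rewrite (_ : (fun _ => _) = cst 0)//; apply/funext => x; rewrite derive_cst.
Qed.

Lemma Ck_add V W k (A : set V) (f g : V -> W) : open A ->
  Ck k A f -> Ck k A g -> Ck k A (fun x => f x + g x).
Proof.
move=> oA; elim: k f g => [|k IHk] f g /=.
  by move=> fc gc x Ax; apply: continuousD; [exact: fc|exact: gc].
move=> [fd fk] [gd gk]; split=> [x Ax|v].
  by apply: differentiableD; [exact: fd|exact: gd].
apply: eq_Ck (IHk _ _ (fk v) (gk v)) => // x Ax.
by rewrite -deriveD//; apply: diff_derivable; [exact: fd|exact: gd].
Qed.

Lemma Ck_sum V W k (A : set V) (I : Type) (r : seq I) (P : pred I) (f : I -> V -> W) :
  open A -> (forall i, P i -> Ck k A (f i)) ->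
  Ck k A (fun x => \sum_(i <- r | P i) f i x).
Proof.
move=> oA fk; rewrite (_ : (fun _ => _) = \sum_(i <- r | P i) f i).
  elim/big_ind : _ => //; first exact: Ck_cst.
  by move=> g h; exact: Ck_add.
by apply/funext => x; rewrite fct_sumE.
Qed.

Lemma Ck_mul V k (A : set V) (f g : V -> R) : open A ->
  Ck k A f -> Ck k A g -> Ck k A (fun x => f x * g x).
Proof.
move=> oA; elim: k f g => [|k IHk] f g.
  by move=> fc gc x Ax; apply: continuousM; [exact: fc|exact: gc].
move=> fk1 gk1; have /= [fd fk] := fk1; have /= [gd gk] := gk1.
split=> [x Ax|v].
  by apply: differentiableM; [exact: fd|exact: gd].
have := Ck_add oA (IHk _ _ (Ck_pred fk1) (gk v)) (IHk _ _ (Ck_pred gk1) (fk v)).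
apply: eq_Ck => // x Ax.
by rewrite [RHS]deriveM//; apply: diff_derivable; [exact: fd|exact: gd].
Qed.

Lemma Ck_inv V k (A : set V) (f : V -> R) : open A ->
  (forall x, A x -> f x != 0) -> Ck k A f -> Ck k A (fun x => (f x)^-1).
Proof.
move=> oA f0; elim: k => [|k IHk].
  by move=> fc x Ax; apply: continuousV; [exact: f0|exact: fc].
move=> fk1; have /= [fd fk] := fk1; split=> [x Ax|v].
  by apply: differentiableV; [exact: fd|exact: f0].
have fV := IHk (Ck_pred fk1).
have := Ck_mul oA (@Ck_cst _ R k A (-1)) (Ck_mul oA (Ck_mul oA fV fV) (fk v)).
apply: eq_Ck => // x Ax; rewrite [RHS]deriveV//; [|exact: f0|exact/diff_derivable/fd].
by rewrite /= mulN1r -exprVn expr2 scaleNr.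
Qed.

Lemma Ck_lin V W W' k (A : set V) (f : V -> W) (L : {linear W -> W'}) :
  open A -> continuous L -> Ck k A f -> Ck k A (L \o f).
Proof.
move=> oA cL; elim: k f => [|k IHk] f /=.
  move=> fc x Ax; apply: continuous_comp; [exact: fc|exact: cL].
move=> [fd fk]; have Lfd x : A x -> differentiable (L \o f) x.
  move=> Ax; apply: differentiable_comp; first exact: fd.
  exact: linear_differentiable.
split=> // v; apply: eq_Ck (IHk _ (fk v)) => // x Ax /=.
rewrite [RHS]deriveE; last exact: Lfd.
rewrite diff_comp//; [|exact: fd|exact: linear_differentiable].
by rewrite /= diff_lin// deriveE//; exact: fd.
Qed.

Lemma Ck_linear V W k (A : set V) (L : {linear V -> W}) :
  open A -> continuous L -> Ck k A L.
Proof.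
move=> oA cL; case: k => [|k] /=; first by move=> x _; exact: cL.
split=> [x _|v]; first exact: linear_differentiable.
rewrite (_ : (fun _ => _) = cst (L v)); first exact: Ck_cst.
apply/funext => x; rewrite deriveE; last exact: linear_differentiable.
by rewrite diff_lin.
Qed.

Lemma Ck_id V k (A : set V) : open A -> Ck k A (@id V).
Proof. by move=> oA; apply: (@Ck_linear _ _ k A idfun) => // x; exact: cvg_id. Qed.

Definition finite_frame V (I : finType) (e : I -> V) (phi : I -> {linear V -> R}) :=
  (forall i, continuous (phi i)) /\ forall v, v = \sum_i phi i v *: e i.

Definition findim V := exists (I : finType) (e : I -> V) phi, finite_frame e phi.

(** By the chain rule, ['D_v (g \o f) x] is the derivative of [g] in the direction ['D_v f x], which
    varies with [x], whereas [Ck] controls fixed directions only. A finite frame of [W] turns it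
    into a sum of products of C^k functions. *)
Lemma Ck_comp V W k (A : set V) (B : set W) (f : V -> W) (g : W -> R) :
  findim W -> open A -> open B -> (forall x, A x -> B (f x)) ->
  Ck k A f -> Ck k B g -> Ck k A (g \o f).
Proof.
move=> [I [e [phi [cphi fe]]]] oA oB fAB; elim: k g => [|k IHk] g.
  move=> fc gc x Ax; apply: continuous_comp; first exact: fc.
  exact/gc/fAB.
move=> fk1 [gd gk]; have /= [fd fk] := fk1.
split=> [x Ax|v].
  by apply: differentiable_comp; [exact: fd|exact/gd/fAB].
have : Ck k A (fun x => \sum_i phi i ('D_v f x) * ('D_(e i) g (f x))).
  apply: Ck_sum => // i _; apply: Ck_mul => //.
    exact: (@Ck_lin _ _ _ k A _ (phi i)).
  apply: (IHk (fun y => 'D_(e i) g y)); [exact: Ck_pred|exact: gk].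
apply: eq_Ck => // x Ax; have dgf := gd _ (fAB _ Ax).
rewrite [RHS]deriveE; last by apply: differentiable_comp => //; exact: fd.
rewrite diff_comp//; last exact: fd.
rewrite /=; have -> : 'd f x v = 'D_v f x by rewrite deriveE//; exact: fd.
rewrite [in RHS](fe ('D_v f x)) linear_sum; apply: eq_bigr => i _.
by rewrite linearZ/= -deriveE.
Qed.

Lemma findim_scalar : findim R.
Proof.
exists unit, (fun=> 1), (fun=> idfun); split; first by move=> _ x; exact: cvg_id.
by move=> x; rewrite (big_pred1 tt) ?[_ *: _]mulr1//; case.
Qed.

Lemma findim_rV n : findim 'rV[R]_n.
Proof.
exists 'I_n, (fun i => delta_mx 0 i).
pose phi (i : 'I_n) (v : 'rV[R]_n) : R := v 0 i.
have lphi i : linear (phi i) by move=> a u v; rewrite /phi !mxE.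
exists (fun i => linear_map (lphi i)); split.
  by move=> i x; exact: coord_continuous.
by move=> v; rewrite [LHS]row_sum_delta.
Qed.

Lemma findim_prod V W : findim V -> findim W -> findim (V * W)%type.
Proof.
move=> [I [e [phi [cphi fe]]]] [J [f [psi [cpsi ff]]]].
exists (I + J)%type, (fun s => match s with inl i => (e i, 0) | inr j => (0, f j) end).
exists (fun s => match s with inl i => [the {linear _ -> _} of phi i \o fst]
  | inr j => [the {linear _ -> _} of psi j \o snd] end); split.
  case=> i /= x; apply: continuous_comp; [exact: cvg_fst|exact: cphi|exact: cvg_snd|exact: cpsi].
case=> v w; rewrite big_sumType /= {1}(fe v) {1}(ff w).
have -> : \sum_i phi i v *: (e i, 0 : W) = (\sum_i phi i v *: e i, 0).
  elim/big_rec2 : _ => // i y1 y2 _ ->.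
  by congr pair; rewrite /= scaler0 addr0.
have -> : \sum_i psi i w *: (0 : V, f i) = (0, \sum_i psi i w *: f i).
  elim/big_rec2 : _ => // i y1 y2 _ ->.
  by congr pair; rewrite /= scaler0 addr0.
by congr pair; rewrite /= ?addr0 ?add0r.
Qed.

End CkCalculus.

(** * Symmetry of mixed second derivatives *)

Section SecondDerivatives.
Variables (R : realType) (V : normedModType R).

Lemma is_derive_line (f : V -> R) (y u : V) (s : R) :
  derivable f (y + s *: u) u ->
  is_derive s 1 (fun s => f (y + s *: u)) ('D_u f (y + s *: u)).
Proof.
have E : (fun h : R => h^-1 *: (f (h *: u + (y + s *: u)) - f (y + s *: u))) =
         (fun h : R => h^-1 *: (f (y + (h *: 1 + s) *: u) - f (y + s *: u))).
  apply/funext => h; congr (_ *: (f _ - _)).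
  by rewrite [h *: 1]mulr1 scalerDl addrCA.
move=> fd; split; first by move: fd; rewrite /derivable E.
by rewrite /derive E.
Qed.

(** The mean value theorem is applied twice: along [u] to the difference of [f] on two parallel
    sides, then along [v] to ['D_u f]. The second difference is symmetric in [u] and [v], which
    [derive_comm] exploits. *)
Lemma second_difference (A : set V) (f : V -> R) (x u v : V) (h : R) :
  0 < h -> (forall y, A y -> differentiable f y) ->
  (forall y, A y -> differentiable (fun z => 'D_u f z) y) ->
  (forall s t, 0 <= s <= h -> 0 <= t <= h -> A (x + s *: u + t *: v)) ->
  exists s t, [/\ 0 <= s <= h, 0 <= t <= h &
    f (x + h *: u + h *: v) - f (x + h *: u) - (f (x + h *: v) - f x) =
    h ^+ 2 * 'D_v (fun z => 'D_u f z) (x + s *: u + t *: v)].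
Proof.
move=> h0 df ddf hA.
pose g (s : R) := f ((x + h *: v) + s *: u) - f (x + s *: u).
pose dg (s : R) := 'D_u f ((x + h *: v) + s *: u) - 'D_u f (x + s *: u).
have h_h : 0 <= h <= h by rewrite ltW/=.
have h_0 : 0 <= (0 : R) <= h by rewrite lexx ltW.
have gd (s : R) : 0 <= s <= h -> is_derive s 1 g (dg s).
  move=> sh; apply: is_deriveB; apply: is_derive_line; apply: diff_derivable; apply: df.
    by rewrite addrAC; exact: hA.
  by have := hA s 0 sh h_0; rewrite scale0r addr0.
have [] := @MVT R g dg 0 h h0.
- by move=> s; rewrite in_itv/= => /andP[s0 sh]; apply: gd; rewrite !ltW.
- apply: derivable_within_continuous => s; rewrite in_itv/= => sh.
  by have [] := gd s sh.
move=> s; rewrite in_itv/= subr0 => /andP[s0 sh] gE.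
have s_h : 0 <= s <= h by rewrite !ltW.
pose k (t : R) := 'D_u f ((x + s *: u) + t *: v).
pose dk (t : R) := 'D_v (fun z => 'D_u f z) ((x + s *: u) + t *: v).
have kd (t : R) : 0 <= t <= h -> is_derive t 1 k (dk t).
  move=> th; apply: (@is_derive_line (fun z => 'D_u f z)).
  by apply: diff_derivable; apply: ddf; exact: hA.
have [] := @MVT R k dk 0 h h0.
- by move=> t; rewrite in_itv/= => /andP[t0 th]; apply: kd; rewrite !ltW.
- apply: derivable_within_continuous => t; rewrite in_itv/= => th.
  by have [] := kd t th.
move=> t; rewrite in_itv/= subr0 => /andP[t0 th] kE.
exists s, t; split => //; first by rewrite !ltW.
move: gE kE; rewrite /g /dg /k /dk !scale0r !addr0.
rewrite (addrAC x (h *: v)) (addrAC x (h *: v) (s *: u)) => gE kE.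
move: gE; rewrite kE => ->; ring.
Qed.

Lemma derive_comm (A : set V) (f : V -> R) (x u v : V) :
  open A -> A x -> Ck 2 A f ->
  'D_v (fun z => 'D_u f z) x = 'D_u (fun z => 'D_v f z) x.
Proof.
move=> oA Ax [df ddf]; apply/eqP; apply: contraT => ab.
set a := 'D_v (fun z => 'D_u f z) x in ab; set b := 'D_u (fun z => 'D_v f z) x in ab.
(* Half the gap: a number within [e] of both [a] and [b] would give |a - b| < |a - b|. *)
pose e := `|a - b| / 2.
have e0 : 0 < e by rewrite divr_gt0// normr_gt0 subr_eq0.
have near_x : nbhs x [set z | A z /\
    (`|a - 'D_v (fun z => 'D_u f z) z| < e /\
     `|b - 'D_u (fun z => 'D_v f z) z| < e)].
  have ca : {for x, continuous (fun z => 'D_v (fun z => 'D_u f z) z)}.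
    exact: ((ddf u).2 v x Ax).
  have cb : {for x, continuous (fun z => 'D_u (fun z => 'D_v f z) z)}.
    exact: ((ddf v).2 u x Ax).
  apply: filterI; first exact: open_nbhs_nbhs.
  apply: filterI.
    by move/cvgrPdist_lt: ca => /(_ e e0).
  by move/cvgrPdist_lt: cb => /(_ e e0).
have [r /= r0 xr] := (iffLR (nbhs_ballP _ _)) near_x.
(* The summand 1 keeps [c] positive when u = v = 0 and makes (r / c)(|u| + |v|) < r strict, so that
   the parallelogram with sides h u and h v lies in the ball. *)
pose c := `|u| + `|v| + 1.
have c0 : 0 < c by rewrite ltr_wpDl// addr_ge0.
pose h := r / c.
have h0 : 0 < h by rewrite divr_gt0.
have inA s t : 0 <= s <= h -> 0 <= t <= h -> ball x r (x + s *: u + t *: v).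
  move=> /andP[s0 sh] /andP[t0 th]; rewrite -ball_normE/=.
  rewrite -addrA opprD addrA subrr add0r normrN.
  apply: (le_lt_trans (ler_normD _ _)); rewrite !normrZ !ger0_norm//.
  apply: (@le_lt_trans _ _ (h * `|u| + h * `|v|)).
    by apply: lerD; exact: ler_wpM2r.
  rewrite -mulrDr /h mulrAC ltr_pdivrMr// ltr_pM2l// /c.
  by rewrite ltrDl.
have [|||s [t [sh th E1]]] := @second_difference A f x u v h h0.
- by [].
- by move=> y Ay; apply: (ddf u).1.
- by move=> s t sh th; have [] := xr _ (inA _ _ sh th).
have [|||s' [t' [sh' th' E2]]] := @second_difference A f x v u h h0.
- by [].
- by move=> y Ay; apply: (ddf v).1.
- by move=> s' t' sh' th'; rewrite addrAC; have [] := xr _ (inA _ _ th' sh').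
have h20 : h ^+ 2 != 0 by rewrite expf_neq0// gt_eqF.
have E : 'D_v (fun z => 'D_u f z) (x + s *: u + t *: v) =
         'D_u (fun z => 'D_v f z) (x + s' *: v + t' *: u).
  apply: (mulfI h20); rewrite -E1 -E2 (addrAC x (h *: v)); ring.
have [_ [d1 _]] := xr _ (inA _ _ sh th).
have [_ [_ d2]] := xr _ (inA _ _ th' sh').
rewrite addrAC in d2.
set q := 'D_u (fun z => 'D_v f z) (x + s' *: v + t' *: u) in E d2.
rewrite E in d1; clearbody a b q.
have : `|a - b| < `|a - b|.
  apply: le_lt_trans (ler_distD q _ _) _.
  have <- : e + e = `|a - b| by apply/esym/splitr.
  apply: ltrD; last by rewrite distrC; exact: d2.
  exact: d1.
by rewrite ltxx.
Qed.

End SecondDerivatives.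

(** * A smooth function that is flat at the origin *)

Section FlatFunction.
Variable R : realType.

(** The negative powers of t are there to make the family stable under differentiation: the
    derivative of a member is a combination of two others, so smoothness follows by induction for
    all [j] at once. *)
Definition flat (j : nat) (t : R) : R :=
  if t <= 0 then 0 else t ^- j * expR (- t^-1).

Lemma flat_le0 j t : t <= 0 -> flat j t = 0.
Proof. by rewrite /flat => ->. Qed.

Lemma flat_gt0 j t : 0 < t -> 0 < flat j t.
Proof.
by move=> t0; rewrite /flat (lt_geF t0) mulr_gt0 ?expR_gt0// invr_gt0 exprn_gt0.
Qed.

Lemma flat_ge0 j t : 0 <= flat j t.
Proof. by case: (ltP 0 t) => [/(flat_gt0 j)/ltW//|/flat_le0->]. Qed.

(** One term of the exponential series suffices: e^(1/t) is at least t^-(j+2) / (j+2)!. Quadratic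
    decay bounds the difference quotient at 0 by a multiple of |t|, so the derivative there is 0. *)
Lemma flat_quadratic j (t : R) : flat j t <= (j.+2)`!%:R * t ^+ 2.
Proof.
have [t0|t0] := leP t 0; first by rewrite flat_le0// mulr_ge0// sqr_ge0.
have it0 : 0 <= t^-1 by rewrite invr_ge0 ltW.
have := expR_ge1Dxn j.+1 it0; set F := (j.+2)`!%:R => H.
have F0 : 0 < F :> R by rewrite ltr0n fact_gt0.
rewrite /flat (lt_geF t0) expRN -exprVn.
rewrite ler_pdivrMr ?expR_gt0//.
apply: (@le_trans _ _ (F * t ^+ 2 * (t^-1 ^+ j.+2 / F))).
  rewrite [leRHS]mulrACA -[in leRHS](addn2 j) exprD.
  rewrite le_eqVlt; apply/orP; left; apply/eqP.
  rewrite !exprVn; field.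
  by rewrite !gt_eqF ?exprn_gt0.
rewrite ler_pM2l ?mulr_gt0 ?exprn_gt0//.
by apply: le_trans H; rewrite lerDr.
Qed.

Lemma is_derive_flat (j : nat) (t : R) :
  is_derive t 1 (flat j) (flat j.+2 t - j%:R * flat j.+1 t).
Proof.
have [t0|t0|->] := ltgtP t 0.
- rewrite !flat_le0 ?ltW// mulr0 subr0.
  apply: (@near_eq_is_derive _ _ _ (cst 0)).
  near=> s; rewrite flat_le0//; apply/ltW.
  by near: s; exact: lt_nbhsl.
- have tn0 : t != 0 by rewrite gt_eqF.
  have iV : is_derive t 1 (fun s : R => s^-1) (- t ^- 2).
    apply: is_derive_eq (is_deriveV tn0 (is_derive_id t 1)) _.
    by rewrite [_ *: _]mulr1.
  have iE : is_derive t 1 (expR \o (fun s : R => - s^-1)) (t ^- 2 * expR (- t^-1)).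
    apply: is_derive_eq (is_derive1_comp (is_derive_expR _) (is_deriveN iV)) _.
    by rewrite opprK mulrC.
  apply: (@near_eq_is_derive _ _ _
      ((fun s : R => s^-1) ^+ j * (expR \o (fun s => - s^-1)))).
    near=> s; rewrite /flat lt_geF//; last by near: s; exact: lt_nbhsr.
    by rewrite -exprVn /= fctE /= exprfctE.
  apply: is_derive_eq (is_deriveM (is_deriveX j iV) iE) _.
  rewrite /flat lt_geF// exprfctE /= /GRing.scale /=.
  case: j => [|j]; first by rewrite !mul0r mulr0 addr0 subr0 !expr0 mul1r.
  rewrite -!exprVn /= !exprS; ring.
- rewrite !flat_le0// mulr0 subr0.
  have cv : (fun h : R => h^-1 *: (flat j (h *: 1 + 0) - flat j 0)) @ 0^' --> (0 : R).
    apply/cvgr0Pnorm_lt => e e0; near=> h.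
    rewrite (flat_le0 j (lexx 0)) subr0 addr0 [h *: 1]mulr1 normrM normfV.
    rewrite (ger0_norm (flat_ge0 _ _)) ltr_pdivrMl ?normr_gt0//; last first.
      by near: h; exact: nbhs_dnbhs_neq.
    apply: le_lt_trans (flat_quadratic _ _) _.
    set F := (j.+2)`!%:R; have F0 : 0 < F :> R by rewrite ltr0n fact_gt0.
    rewrite -(real_normK (num_real h)) expr2 mulrCA ltr_pM2l; last first.
      by rewrite normr_gt0; near: h; exact: nbhs_dnbhs_neq.
    rewrite -ltr_pdivlMl//.
    near: h; apply: dnbhs0_lt.
    by rewrite mulr_gt0// invr_gt0 ltr0n fact_gt0.
  by split; [apply/cvg_ex; exists 0; exact: cv|apply: cvg_lim => //; exact: cv].
Unshelve. all: by end_near. Qed.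

Lemma Ck_flat k j : Ck k [set: R] (flat j).
Proof.
elim: k j => [|k IHk] j /=.
  move=> t _; apply: differentiable_continuous; apply/derivable1_diffP.
  by have [] := is_derive_flat j t.
have fd t : differentiable (flat j) t.
  by apply/derivable1_diffP; have [] := is_derive_flat j t.
split=> // v.
rewrite (_ : (fun _ => _) =
    fun t => v * (flat j.+2 t + - j%:R * flat j.+1 t)); last first.
  apply/funext => t; rewrite deriveE// -[v in LHS]mulr1 [v * 1](_ : _ = v *: 1)//.
  rewrite linearZ/= -deriveE//; have [_ ->] := is_derive_flat j t.
  by rewrite mulNr.
apply: Ck_mul; [exact: openT|exact: Ck_cst|].
apply: Ck_add; [exact: openT|exact: IHk|].
by apply: Ck_mul; [exact: openT|exact: Ck_cst|exact: IHk].
Qed.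

End FlatFunction.

(** * Smooth functions and tangent vectors on manifolds *)

Section Ck_pairs.
Variables (R : realType) (V W W' : normedModType R).

Lemma Ck_pair k (A : set V) (f : V -> W) (g : V -> W') : open A ->
  Ck k A f -> Ck k A g -> Ck k A (fun x => (f x, g x)).
Proof.
move=> oA fk gk.
have l1 : linear (fun x : W => (x, 0 : W')).
  by move=> a x y; congr pair; rewrite /= scaler0 addr0.
have l2 : linear (fun x : W' => (0 : W, x)).
  by move=> a x y; congr pair; rewrite /= scaler0 addr0.
have /= := Ck_add oA (@Ck_lin _ _ _ _ k A f (linear_map l1) oA _ fk)
                  (@Ck_lin _ _ _ _ k A g (linear_map l2) oA _ gk).
rewrite (_ : (fun _ => _) = (fun x => (f x, g x))).
  apply => x; apply: (@cvg_pair _ _ _ _ (nbhs _) (nbhs _)) => /=;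
    (try exact: cvg_id); exact: cst_continuous.
by apply/funext => x; congr pair; rewrite /= ?addr0 ?add0r.
Qed.

End Ck_pairs.

Lemma derive_comp (R : realType) (U V W : normedModType R) (f : U -> V)
    (g : V -> W) (x u : U) :
  differentiable f x -> differentiable g (f x) ->
  'D_u (g \o f) x = 'D_('D_u f x) g (f x).
Proof.
move=> df dg; rewrite deriveE; last exact: differentiable_comp.
by rewrite diff_comp//= -!deriveE.
Qed.

Section ChartChange.
Variables (R : realType) (V : normedModType R) (N : manifold V).
Implicit Types (c d : chart N V) (p : N).

Lemma transition_differentiable c d p : atlas c -> atlas d -> cdom c p ->
  cdom d p -> differentiable (d \o cinv c) (c p).
Proof.
move=> ac ad cp dp; have [+ _] := atlas_smooth ac ad 1.
by apply; split; [exact: cmap_cod|rewrite /= cmapK].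
Qed.

Lemma frame_is_linear c p : atlas c -> cdom c p -> linear (frame c p).
Proof.
move=> ac cp a u v; rewrite /frame.
have dc : differentiable (chart_at p \o cinv c) (c p).
  apply: transition_differentiable => //; [exact: chart_at_atlas|exact: chart_at_dom].
by rewrite !deriveE// linearP.
Qed.

Lemma near_chartK c d p : cdom c p -> cdom d p ->
  \forall x \near c p, ccod c x /\ cdom d (cinv c x).
Proof.
move=> cp dp; have : (ccod c `&` cinv c @^-1` cdom d) (c p).
  by split; [exact: cmap_cod|rewrite /= cmapK].
by move=> H; apply: open_nbhs_nbhs; split => //; apply: open_chart_preimage; exact: open_cdom.
Qed.

(** Cocycle rule for the Jacobians of chart changes; the case e = c makes [frame] and [coords]
    mutually inverse. *)
Lemma derive_transition c d e p (v : V) : atlas c -> atlas d -> atlas e ->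
  cdom c p -> cdom d p -> cdom e p ->
  'D_('D_v (d \o cinv c) (c p)) (e \o cinv d) (d p) = 'D_v (e \o cinv c) (c p).
Proof.
move=> ac ad ae cp dp ep.
have := @derive_comp _ _ _ _ (d \o cinv c) (e \o cinv d) (c p) v.
rewrite /= cmapK// => <- //; [|exact: transition_differentiable|exact: transition_differentiable].
apply: near_eq_derive; apply: filterS (near_chartK cp dp) => x [cx dx] /=.
by rewrite cmapK.
Qed.

Lemma derive_chart_id c p (v : V) : cdom c p -> 'D_v (c \o cinv c) (c p) = v.
Proof.
move=> cp; rewrite -[RHS](derive_id (c p)).
apply: near_eq_derive; apply: filterS (near_chartK cp cp) => x [cx dx] /=.
by rewrite cinvK.
Qed.

Lemma frameK c p : atlas c -> cdom c p -> cancel (frame c p) (coords c p).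
Proof.
move=> ac cp v; rewrite /frame /coords /tderiv.
by rewrite derive_transition ?derive_chart_id//;
  [exact: chart_at_atlas|exact: chart_at_dom].
Qed.

Lemma coordsK c p : atlas c -> cdom c p -> cancel (coords c p) (frame c p).
Proof.
move=> ac cp v; rewrite /frame /coords /tderiv.
by rewrite derive_transition ?derive_chart_id//;
  try exact: chart_at_atlas; exact: chart_at_dom.
Qed.

Lemma coords_chart_at p (v : V) : coords (chart_at p) p v = v.
Proof. by apply: derive_chart_id; exact: chart_at_dom. Qed.

Lemma frame_chart_at p (v : V) : frame (chart_at p) p v = v.
Proof. by apply: derive_chart_id; exact: chart_at_dom. Qed.

End ChartChange.

Section SmoothFunctions.
Variables (R : realType) (V : normedModType R) (N : manifold V).
Hypothesis fV : findim V.
Implicit Types (A B : set N) (f g : N -> R).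

Lemma smooth_fun_subset A B f : B `<=` A -> smooth_fun A f -> smooth_fun B f.
Proof.
move=> BA sf c ac k; apply: Ck_subset (sf c ac k) => x [cx Bx].
by split => //; exact: BA.
Qed.

Lemma eq_smooth_fun A f g : open A -> (forall p, A p -> f p = g p) ->
  smooth_fun A f -> smooth_fun A g.
Proof.
move=> oA fg sf c ac k; apply: eq_Ck (sf c ac k); first exact: open_chart_preimage.
by move=> x [cx Ax]; exact: fg.
Qed.

Lemma smooth_fun_local A f :
  (forall p, A p -> exists O, [/\ open O, O p & smooth_fun O f]) -> smooth_fun A f.
Proof.
move=> fA c ac k; apply: Ck_local => x [cx Ax]; have [B [oB Bp sf]] := fA _ Ax.
exists (ccod c `&` cinv c @^-1` B) => //; exact: sf.
Qed.

(** One chart suffices: in any other chart, [f] is its expression in [c] composed with a smooth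
    transition map. Finite dimension enters through [Ck_comp]. *)
Lemma smooth_fun_chart A f c : atlas c -> open A -> A `<=` cdom c ->
  smooth_on (ccod c `&` cinv c @^-1` A) (f \o cinv c) -> smooth_fun A f.
Proof.
move=> ac oA Ac sf d ad k.
have oB : open (ccod d `&` cinv d @^-1` A) by exact: open_chart_preimage.
have : Ck k (ccod d `&` cinv d @^-1` A) ((f \o cinv c) \o (c \o cinv d)).
  apply: (Ck_comp fV oB (open_chart_preimage c oA)) (sf k).
    move=> x [dx Ax]; split; first exact/cmap_cod/Ac.
    by rewrite /= cmapK//; exact: Ac.
  apply: Ck_subset (atlas_smooth ad ac k) => x [dx Ax]; split => //; exact: Ac.
by apply: eq_Ck => // x [dx Ax] /=; rewrite cmapK//; exact: Ac.
Qed.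

Lemma smooth_fun_cst A (a : R) : smooth_fun A (cst a).
Proof. by move=> c ac k; exact: Ck_cst. Qed.

Lemma smooth_funD A f g : open A -> smooth_fun A f -> smooth_fun A g ->
  smooth_fun A (fun p => f p + g p).
Proof.
move=> oA sf sg c ac k.
by apply: (Ck_add _ (sf c ac k) (sg c ac k)); exact: open_chart_preimage.
Qed.

Lemma smooth_funM A f g : open A -> smooth_fun A f -> smooth_fun A g ->
  smooth_fun A (fun p => f p * g p).
Proof.
move=> oA sf sg c ac k.
by apply: (Ck_mul _ (sf c ac k) (sg c ac k)); exact: open_chart_preimage.
Qed.

Lemma smooth_funV A f : open A -> (forall p, A p -> f p != 0) ->
  smooth_fun A f -> smooth_fun A (fun p => (f p)^-1).
Proof.
move=> oA f0 sf c ac k; apply: (Ck_inv _ _ (sf c ac k)).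
  exact: open_chart_preimage.
by move=> x [cx Ax]; exact: f0.
Qed.

Lemma smooth_fun_sum A (I : Type) (r : seq I) (P : pred I) (f : I -> N -> R) :
  open A -> (forall i, P i -> smooth_fun A (f i)) ->
  smooth_fun A (fun p => \sum_(i <- r | P i) f i p).
Proof.
move=> oA sf c ac k.
by apply: Ck_sum => [|i Pi]; [exact: open_chart_preimage|exact: sf].
Qed.

Lemma smooth_fun_coord c (phi : {linear V -> R}) : continuous phi -> atlas c ->
  smooth_fun (cdom c) (fun p : N => phi (c p)).
Proof.
move=> cphi ac d ad k; apply: (@Ck_lin _ _ _ _ _ _ (c \o cinv d) phi) => //.
  by apply: open_chart_preimage; exact: open_cdom.
exact: atlas_smooth.
Qed.

Lemma smooth_fun_differentiable A f c p : smooth_fun A f -> atlas c -> A p ->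
  cdom c p -> differentiable (f \o cinv c) (c p).
Proof.
move=> sf ac Ap cp; have [+ _] := sf c ac 1; apply.
by split; [exact: cmap_cod|rewrite /= cmapK].
Qed.

Lemma smooth_fun_differentiable_at A f p : smooth_fun A f -> A p ->
  differentiable (f \o cinv (chart_at p)) (chart_at p p).
Proof.
move=> sf Ap; apply: (smooth_fun_differentiable sf) => //.
  exact: chart_at_atlas.
exact: chart_at_dom.
Qed.

Section Tderiv.
Variables (A : set N) (p : N).
Hypotheses (Ap : A p).
Implicit Types v : V.

Lemma tderivD v f g : smooth_fun A f -> smooth_fun A g ->
  tderiv p v (fun q => f q + g q) = tderiv p v f + tderiv p v g.
Proof.
move=> sf sg; rewrite /tderiv.
rewrite -deriveD//; apply: diff_derivable.
  exact: (smooth_fun_differentiable_at sf).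
exact: (smooth_fun_differentiable_at sg).
Qed.

Lemma tderivM v f g : smooth_fun A f -> smooth_fun A g ->
  tderiv p v (fun q => f q * g q) = f p * tderiv p v g + g p * tderiv p v f.
Proof.
move=> sf sg; rewrite /tderiv.
rewrite [LHS](@deriveM _ _ (f \o cinv (chart_at p)) (g \o cinv (chart_at p))).
- by rewrite /= cmapK//; exact: chart_at_dom.
- by apply: diff_derivable; exact: (smooth_fun_differentiable_at sf).
- by apply: diff_derivable; exact: (smooth_fun_differentiable_at sg).
Qed.

Lemma tderiv_cst v (a : R) : tderiv p v (cst a) = 0.
Proof. exact: derive_cst. Qed.

Lemma tderiv_sum v (I : Type) (r : seq I) (P : pred I) (f : I -> N -> R) :
  open A -> (forall i, P i -> smooth_fun A (f i)) ->
  tderiv p v (fun q => \sum_(i <- r | P i) f i q) =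
  \sum_(i <- r | P i) tderiv p v (f i).
Proof.
move=> oA sf; elim: r => [|i r IHr].
  rewrite big_nil -[RHS](tderiv_cst v 0); congr tderiv.
  by apply/funext => q; rewrite big_nil.
rewrite big_cons -IHr; case: ifPn => Pi.
  rewrite -tderivD; [|exact: sf|exact: smooth_fun_sum].
  by congr tderiv; apply/funext => q; rewrite big_cons Pi.
by congr tderiv; apply/funext => q; rewrite big_cons (negbTE Pi).
Qed.

Lemma tderiv_is_linear f : smooth_fun A f -> scalar (fun v => tderiv p v f).
Proof.
move=> sf a u v; rewrite /tderiv.
by rewrite !deriveE ?linearP//; exact: (smooth_fun_differentiable_at sf).
Qed.

Lemma eq_tderiv v f g : open A -> (forall q, A q -> f q = g q) ->
  tderiv p v f = tderiv p v g.
Proof.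
move=> oA fg; apply: near_eq_derive; near=> x => /=; apply: fg.
near: x; apply: (cinv_continuous (cmap_cod (chart_at_dom p))).
by apply: open_nbhs_nbhs; rewrite cmapK//; exact: chart_at_dom.
Unshelve. all: by end_near. Qed.

Lemma tderiv_chart c v f : atlas c -> cdom c p -> smooth_fun A f ->
  tderiv p v f = 'D_(coords c p v) (f \o cinv c) (c p).
Proof.
move=> ac cp sf; rewrite /tderiv /coords /tderiv.
have ap := chart_at_dom p.
have := @derive_comp _ _ _ _ (c \o cinv (chart_at p)) (f \o cinv c) (chart_at p p) v.
rewrite /= cmapK// => <-//; last 2 first.
- by apply: transition_differentiable => //; exact: chart_at_atlas.
- exact: (smooth_fun_differentiable sf).
apply: near_eq_derive; apply: filterS (near_chartK ap cp) => x [cx dx] /=.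
by rewrite cmapK.
Qed.

Lemma tderiv_frame c v f : atlas c -> cdom c p -> smooth_fun A f ->
  tderiv p (frame c p v) f = 'D_v (f \o cinv c) (c p).
Proof. by move=> ac cp sf; rewrite (tderiv_chart _ ac)// frameK. Qed.

End Tderiv.
End SmoothFunctions.

(** * Iterated Lie derivatives and the bracket *)

Section LieDerivatives.
Variables (R : realType) (V : normedModType R) (N : manifold V).
Hypothesis fV : findim V.
Implicit Types (A : set N) (f : N -> R) (X Z : N -> V) (c : chart N V) (p : N).

Lemma coords_field_smooth X c : smooth_field X -> atlas c ->
  smooth_on (ccod c) ((fun p => coords c p (X p)) \o cinv c).
Proof.
move=> sX ac k; apply: Ck_subset (sX c ac c ac k) => x cx.
by split => //; exact: cinv_dom.
Qed.

Lemma lie_chart A f X c p : atlas c -> cdom c p -> A p -> smooth_fun A f ->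
  lie X f p = 'D_(coords c p (X p)) (f \o cinv c) (c p).
Proof. by move=> ac cp Ap sf; rewrite /lie (tderiv_chart _ _ ac cp sf). Qed.

Lemma smooth_lie A f X : open A -> smooth_field X -> smooth_fun A f ->
  smooth_fun A (lie X f).
Proof.
move=> oA sX sf c ac k; have [I [e [phi [cphi fe]]]] := fV.
have oB : open (ccod c `&` cinv c @^-1` A) by exact: open_chart_preimage.
have : Ck k (ccod c `&` cinv c @^-1` A)
    (fun x => \sum_i phi i (coords c (cinv c x) (X (cinv c x))) *
                     'D_(e i) (f \o cinv c) x).
  apply: Ck_sum => // i _; apply: Ck_mul => //.
    apply: (@Ck_lin _ _ _ _ k _ ((fun p => coords c p (X p)) \o cinv c) (phi i)) => //.
    by apply: Ck_subset (coords_field_smooth sX ac k) => x [].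
  by have [_] := sf c ac k.+1; exact.
apply: eq_Ck => // x [cx Ax].
rewrite /= (lie_chart X ac _ _ sf)//; last exact: cinv_dom.
rewrite cinvK//.
have df : differentiable (f \o cinv c) x by have [+ _] := sf c ac 1; exact.
rewrite [in RHS](fe (coords _ _ _)) deriveE// linear_sum; apply: eq_bigr => i _.
by rewrite linearZ/= -deriveE.
Qed.

(** Product rule in the chart at [p]: writing X = sum_i X^i e_i, one term differentiates the
    coefficients X^i, the other is the second derivative of [f] with X frozen at its value at [p].
    Only the latter is symmetric in X and Z. *)
Lemma lie_lie A f X Z p (I : finType) (e : I -> V) (phi : I -> {linear V -> R}) :
  finite_frame e phi -> open A -> A p -> smooth_field X -> smooth_fun A f ->
  lie Z (lie X f) p =
  tderiv p (tderiv p (Z p) (fun q => coords (chart_at p) q (X q))) f +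
  'D_(Z p) (fun x => 'D_(X p) (f \o cinv (chart_at p)) x) (chart_at p p).
Proof.
move=> [cphi fe] oA Ap sX sf; set c := chart_at p.
have ac : atlas c by exact: chart_at_atlas.
have cp : cdom c p by exact: chart_at_dom.
pose B := ccod c `&` cinv c @^-1` A.
have oB : open B by exact: open_chart_preimage.
have Bp : B (c p) by split; [exact: cmap_cod|rewrite /= cmapK].
pose F := f \o cinv c.
pose Xc := (fun q => coords c q (X q)) \o cinv c.
have sXc k : Ck k (ccod c) Xc by exact: coords_field_smooth.
have sF k : Ck k B F by exact: sf.
have dF x : B x -> differentiable F x by exact: (sF 1).1.
have ddF v x : B x -> differentiable (fun y => 'D_v F y) x by exact: ((sF 2).2 v).1.
have DF v x : B x -> 'D_v F x = \sum_i phi i v * 'D_(e i) F x.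
  move=> Bx; rewrite {1}(fe v) deriveE; last exact: dF.
  rewrite linear_sum; apply: eq_bigr => i _.
  by rewrite linearZ/= -deriveE//; exact: dF.
have dXc : differentiable Xc (c p) by apply: (sXc 1).1; exact: cmap_cod.
have Xcp : Xc (c p) = X p by rewrite /Xc /= cmapK// coords_chart_at.
have dphi i : differentiable (phi i \o Xc) (c p).
  by apply: differentiable_comp => //; exact: linear_differentiable.
have nB : \forall x \near c p, B x by exact: open_nbhs_nbhs.
transitivity ('D_(Z p) (\sum_i (phi i \o Xc) * (fun x => 'D_(e i) F x)) (c p)).
  apply: near_eq_derive; apply: filterS nB => x [cx Ax] /=.
  rewrite (lie_chart X ac _ _ sf)//; last exact: cinv_dom.
  by rewrite cinvK// DF// fct_sumE.
have E : 'D_(Z p) (\sum_i (phi i \o Xc) * (fun x => 'D_(e i) F x)) (c p) =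
  \sum_i 'D_(Z p) ((phi i \o Xc) * (fun x => 'D_(e i) F x)) (c p).
  have := @derive_sum R V R #|I| (fun i => (phi (enum_val i) \o Xc) *
    (fun x => 'D_(e (enum_val i)) F x)) (c p) (Z p).
  rewrite !(reindex _ (onW_bij _ (@enum_val_bij I)))/=; apply.
  by move=> i; apply/diff_derivable/differentiableM => //; exact: ddF.
rewrite {}E.
rewrite (@near_eq_derive _ _ _ _
  (\sum_i cst (phi i (X p)) * (fun x => 'D_(e i) F x))); last first.
  by apply: filterS nB => x Bx; rewrite /= DF// fct_sumE.
have E : 'D_(Z p) (\sum_i cst (phi i (X p)) * (fun x => 'D_(e i) F x)) (c p) =
  \sum_i 'D_(Z p) (cst (phi i (X p)) * (fun x => 'D_(e i) F x)) (c p).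
  have := @derive_sum R V R #|I| (fun i => cst (phi (enum_val i) (X p)) *
    (fun x => 'D_(e (enum_val i)) F x)) (c p) (Z p).
  rewrite !(reindex _ (onW_bij _ (@enum_val_bij I)))/=; apply.
  by move=> i; apply/diff_derivable/differentiableM => //; exact: ddF.
rewrite {}E /tderiv -/c -/F -/Xc DF// -big_split /=; apply: eq_bigr => i _.
rewrite !deriveM; try by apply: diff_derivable => //; exact: ddF.
rewrite derive_cst /= Xcp scaler0 addr0 addrC; congr (_ + _).
rewrite [RHS]mulrC; congr (_ * _).
rewrite derive_comp//; last exact: linear_differentiable.
by rewrite deriveE ?diff_lin//; exact: linear_differentiable.
Qed.

(** The second-derivative terms of [lie_lie] cancel by [derive_comm]; the remaining vector is the
    chart formula that defines [bracket]. *)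
Lemma lie_bracket A f X Z p : open A -> A p -> smooth_field X -> smooth_field Z ->
  smooth_fun A f ->
  tderiv p (bracket Z X p) f = lie Z (lie X f) p - lie X (lie Z f) p.
Proof.
move=> oA Ap sX sZ sf; have [I [e [phi fe]]] := fV.
rewrite (lie_lie Z fe oA Ap sX sf) (lie_lie X fe oA Ap sZ sf).
have ap := chart_at_dom p.
rewrite (@derive_comm _ _ (ccod (chart_at p) `&` cinv (chart_at p) @^-1` A)
  _ _ (X p) (Z p)); last 3 first.
- exact: open_chart_preimage.
- by split; [exact: cmap_cod|rewrite /= cmapK].
- exact: (sf _ (chart_at_atlas p) 2).
have cancelD (a b d : R) : a + d - (b + d) = a - b by ring.
rewrite cancelD.
have lt := tderiv_is_linear Ap sf.
have -> : bracket Z X p =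
    -1 *: tderiv p (X p) (fun q => coords (chart_at p) q (Z q)) +
    tderiv p (Z p) (fun q => coords (chart_at p) q (X q)).
  by rewrite scaleN1r addrC.
by rewrite lt mulN1r addrC.
Qed.

End LieDerivatives.

(** * Slices, projections and the diagonal of the product manifold *)

Section ProductFunctions.
Variables (R : realType) (V : normedModType R) (M : manifold V).
Hypothesis fV : findim V.
Local Notation MM := (prod_manifold M M).
Implicit Types (c d : chart M V).

Lemma atlas_prod c d : atlas c -> atlas d -> atlas (prod_chart c d : chart MM _).
Proof. by move=> ac ad; exists c, d. Qed.

Lemma smooth_slice (A : set MM) (f : MM -> R) (m : M) : open A -> smooth_fun A f ->
  smooth_fun [set x : M | A (x, m)] (fun x => f (x, m)).
Proof.
move=> oA sf c ac k; set d := chart_at m.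
have ad : atlas d by exact: chart_at_atlas.
have dm : cdom d m by exact: chart_at_dom.
have oA' : open [set x : M | A (x, m)].
  apply: (@open_comp _ _ (fun x : M => (x, m)) A) => // x _.
  apply: (@cvg_pair _ _ _ _ (nbhs _) (nbhs _)) => /=; [exact: cvg_id|exact: cst_continuous].
have oB := open_chart_preimage c oA'.
have := @Ck_comp _ _ _ k _ _ (fun x => (x, d m)) (f \o cinv (prod_chart c d))
  (findim_prod fV fV) oB (open_chart_preimage (prod_chart c d : chart MM _) oA).
move=> /(_ _ _ (sf _ (atlas_prod ac ad) k)).
have -> : (f \o cinv (prod_chart c d)) \o (fun x => (x, d m)) = (fun x => f (x, m)) \o cinv c.
  by apply/funext => x /=; rewrite cmapK.
apply.
  by move=> x [cx Ax]; split; [split=> //; exact: cmap_cod|rewrite /= cmapK].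
by apply: Ck_pair => //; [exact: Ck_id|exact: Ck_cst].
Qed.

Lemma smooth_fst (A : set M) (f : M -> R) : open A -> smooth_fun A f ->
  smooth_fun [set p : MM | A p.1] (fun p : MM => f p.1).
Proof.
move=> oA sf _ [c [d [ac ad ->]]] k.
have oA' : open [set p : MM | A p.1].
  by apply: (@open_comp _ _ (fun p : M * M => p.1) A) => // x _; exact: cvg_fst.
have oB := open_chart_preimage (prod_chart c d : chart MM _) oA'.
have := @Ck_comp _ _ _ k _ _ fst (f \o cinv c) fV oB (open_chart_preimage c oA).
apply; last exact: sf.
  by move=> x [[/= cx dx] Ax].
by apply: Ck_linear => // x; exact: cvg_fst.
Qed.

Lemma smooth_snd (A : set M) (f : M -> R) : open A -> smooth_fun A f ->
  smooth_fun [set p : MM | A p.2] (fun p : MM => f p.2).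
Proof.
move=> oA sf _ [c [d [ac ad ->]]] k.
have oA' : open [set p : MM | A p.2].
  by apply: (@open_comp _ _ (fun p : M * M => p.2) A) => // x _; exact: cvg_snd.
have oB := open_chart_preimage (prod_chart c d : chart MM _) oA'.
have := @Ck_comp _ _ _ k _ _ snd (f \o cinv d) fV oB (open_chart_preimage d oA).
apply; last exact: sf.
  by move=> x [[/= cx dx] Ax].
by apply: Ck_linear => // x; exact: cvg_snd.
Qed.

Lemma smooth_diag (A : set MM) (f : MM -> R) : open A -> smooth_fun A f ->
  smooth_fun [set x : M | A (x, x)] (fun x => f (x, x)).
Proof.
move=> oA sf c ac k.
have oA' : open [set x : M | A (x, x)].
  apply: (@open_comp _ _ (fun x : M => (x, x)) A) => // x _.
  by apply: (@cvg_pair _ _ _ _ (nbhs _) (nbhs _)) => /=; exact: cvg_id.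
have oB := open_chart_preimage c oA'.
have := @Ck_comp _ _ _ k _ _ (fun x => (x, x)) (f \o cinv (prod_chart c c))
  (findim_prod fV fV) oB (open_chart_preimage (prod_chart c c : chart MM _) oA).
apply; last exact: (sf _ (atlas_prod ac ac) k).
  by move=> x [cx Ax].
by apply: Ck_pair => //; exact: Ck_id.
Qed.

End ProductFunctions.

(** * Smooth partitions of unity *)

Section Bumps.
Variables (R : realType) (n : nat) (M : manifold 'rV[R]_n).
Hypothesis hM : hausdorff_space M.

(** The norm of row vectors is the maximum norm, while the bump is built on the Euclidean square,
    which is smooth; this compares the two balls. *)
Lemma sqnorm_lt (r : R) (x : 'rV[R]_n) : 0 <= r ->
  \sum_i x 0 i ^+ 2 < r ^+ 2 -> `|x| <= r.
Proof.
move=> r0 xr; rewrite (_ : `|x| = mx_norm x)// mx_normrE; apply: bigmax_le => // -[i j] _ /=.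
rewrite (ord1 i) -(ler_pXn2r (n := 2))// ?nnegrE// real_normK ?num_real//.
apply: le_trans (ltW xr); rewrite (bigD1 j)//= lerDl.
by apply: sumr_ge0 => k _; exact: sqr_ge0.
Qed.

Lemma bump_exists (p : M) (A : set M) : open A -> A p ->
  exists (b : M -> R) (K : set M),
    [/\ smooth_fun setT b /\ (forall q, 0 <= b q),
        open [set q | 0 < b q] /\ 0 < b p,
        compact K, K `<=` A `&` cdom (chart_at p) & forall q, ~ K q -> b q = 0].
Proof.
move=> oA Ap; set c := chart_at p.
have ac : atlas c by exact: chart_at_atlas.
have cp : cdom c p by exact: chart_at_dom.
have : nbhs (c p) (ccod c `&` cinv c @^-1` A).
  apply: open_nbhs_nbhs; split; first exact: open_chart_preimage.
  by split; [exact: cmap_cod|rewrite /= cmapK].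
move=> /nbhs_closedballP[r]; rewrite closed_ballE// => rA.
pose u (x : 'rV[R]_n) := r%:num ^+ 2 - \sum_i (x 0 i - c p 0 i) ^+ 2.
have su k : Ck k setT u.
  apply: (@Ck_add _ _ _ _ _ (cst (r%:num ^+ 2))); [exact: openT|exact: Ck_cst|].
  rewrite (_ : (fun x : 'rV[R]_n => - _) =
      (fun x : 'rV[R]_n => \sum_i (-1 * ((x 0 i - c p 0 i) * (x 0 i - c p 0 i))))).
    apply: Ck_sum => [|i _]; first exact: openT.
    apply: Ck_mul; [exact: openT|exact: Ck_cst|].
    have sc : Ck k setT (fun x : 'rV[R]_n => x 0 i - c p 0 i).
      apply: (Ck_add openT _ (@Ck_cst _ _ _ k setT (- c p 0 i))).
      pose phi (x : 'rV[R]_n) : R := x 0 i.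
      have lphi : linear phi by move=> a x y; rewrite /phi !mxE.
      apply: (@Ck_linear _ _ _ k setT (linear_map lphi)); first exact: openT.
      by move=> x; exact: coord_continuous.
    by apply: Ck_mul => //; exact: openT.
  apply/funext => x; rewrite -sumrN; apply: eq_bigr => i _.
  by rewrite mulN1r expr2.
have su' k : Ck k setT (flat 0 \o u).
  exact: (@Ck_comp _ _ _ k setT setT u (@flat R 0) (findim_scalar R) openT openT
    (fun _ _ => I) (su k) (@Ck_flat R k 0)).
have cu : continuous u by move=> x; exact: (su 0).
(* Outside [cdom c] the total map [c] takes arbitrary values, so the extension by zero has to be
   explicit. *)
pose b q := if `[< cdom c q >] then flat 0 (u (c q)) else 0.
pose K := cinv c @` closed_ball_ Num.norm (c p) r%:num.
have cK : compact K.
  apply: continuous_compact.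
    apply: continuous_in_subspaceT => x; rewrite inE => /rA[cx _].
    exact: cinv_continuous.
  apply: bounded_closed_compact; last exact: closed_closed_ball_.
  exists (`|c p| + r%:num); split; first exact: num_real.
  move=> s rs x /=; rewrite /closed_ball_ /= distrC => xr; apply/ltW/(le_lt_trans _ rs).
  by rewrite -lerBlDl; apply: le_trans xr; exact: lerB_dist.
have b0 q : ~ K q -> b q = 0.
  move=> Kq; rewrite /b; case: asboolP => // cq; apply: flat_le0.
  rewrite leNgt; apply/negP => u0; apply: Kq; exists (c q); last by rewrite cmapK.
  rewrite /closed_ball_ /= distrC; apply: sqnorm_lt => //.
  move: u0; rewrite subr_gt0.
  by under [X in _ -> X < _]eq_bigr do rewrite !mxE.
have sb1 : smooth_fun (cdom c) b.
  apply: (smooth_fun_chart (findim_rV R n) ac) => //; first exact: open_cdom.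
  move=> k; apply: (@eq_Ck _ _ _ _ _ (flat 0 \o u)).
  - by apply: open_chart_preimage; exact: open_cdom.
  - by move=> x [cx dx]; rewrite /= /b asboolT// cinvK.
  - exact: Ck_subset (su' k).
exists b, K; split => //.
- split; last by move=> q; rewrite /b; case: ifP => // _; exact: flat_ge0.
  (* The domain [cdom c] and the complement of [K] cover M. The latter is open because compact sets
     of a Hausdorff space are closed, and [b] vanishes on it. *)
  apply: smooth_fun_local => q _.
  have [cq|ncq] := pselect (cdom c q); first by exists (cdom c); split => //; exact: open_cdom.
  exists (~` K); split.
  + by apply: closed_openC; exact: compact_closed.
  + by move=> [x /rA[cx _] xq]; apply: ncq; rewrite -xq; exact: cinv_dom.
  + apply: (@eq_smooth_fun _ _ _ _ (cst 0)); last exact: smooth_fun_cst.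
      by apply: closed_openC; exact: compact_closed.
    by move=> x Kx; rewrite b0.
- split; last first.
    rewrite /b asboolT// flat_gt0// /u big1 ?subr0// => i _.
    by rewrite subrr expr0n.
  have -> : [set q | 0 < b q] = cdom c `&` c @^-1` [set x | 0 < u x].
    apply/seteqP; split => q /=.
      rewrite /b; case: asboolP; last by rewrite ltxx.
      move=> cq; case: (ltP 0 (u (c q))) => // /(flat_le0 0) ->.
      by rewrite ltxx.
    by move=> [cq uq]; rewrite /b asboolT// flat_gt0.
  have oU : open [set x | 0 < u x].
    by apply: (@open_comp _ _ u [set y | 0 < y]) => [x _|]; [exact: cu|exact: open_gt].
  rewrite openE => q [cq uq]; apply: filterI.
    by apply: open_nbhs_nbhs; split => //; exact: open_cdom.
  by apply: (cmap_continuous cq); exact: open_nbhs_nbhs.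
- by move=> _ [x /rA[cx Ax] <-]; split => //; exact: cinv_dom.
Qed.

End Bumps.

(** Compactness in its near-covering form: that [J] contains every member of [G] through [x] holds
    for [x] near any given point and [J] large, so a single finite [J] serves all of [K]. *)
Lemma compact_locally_finite (T : topologicalType) (G : set (set T)) (K : set T) :
  compact K ->
  (forall p : T, exists2 N, nbhs p N & finite_set [set B | G B /\ B `&` N !=set0]) ->
  finite_set [set B | G B /\ B `&` K !=set0].
Proof.
move=> /compact_near_coveringP cK lf.
(* [F] is generated by the up-closures of finite subfamilies. *)
pose F : set_system (set (set T)) :=
  [set Phi | exists2 J0, finite_set J0 & forall J, J0 `<=` J -> Phi J].
have FF : Filter F.
  split.
  - by exists set0.
  - move=> P Q [J fJ HP] [J' fJ' HQ]; exists (J `|` J'); first by rewrite finite_setU.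
    by move=> L JL; split; [apply: HP|apply: HQ] => x Jx; apply: JL; [left|right].
  - by move=> P Q PQ [J fJ HP]; exists J => // L JL; exact/PQ/HP.
have [] := cK _ F (fun J x => forall B, G B -> B x -> J B) FF.
  move=> x _; have [N xN fN] := lf x.
  exists (N, [set J | [set B | G B /\ B `&` N !=set0] `<=` J]).
    by split => //; exists [set B | G B /\ B `&` N !=set0].
  move=> [y J] [/= Ny NJ] B GB By; apply: NJ; split => //; by exists y.
move=> J fJ KJ; apply: sub_finite_set fJ => B [GB [x [Bx Kx]]].
exact: (KJ J _ x).
Qed.

Section PartitionOfUnity.
Variables (R : realType) (n : nat) (M : manifold 'rV[R]_n).
Hypotheses (hM : hausdorff_space M) (pM : paracompact M).

(* Two successive refinements: the bumps indexed by [G2] have their supports in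
   members of [G1], which are relatively compact and hence meet only finitely
   many members of [G2]; this makes the family of supports locally finite. *)
Lemma locally_finite_bumps : exists (I : choiceType) (c : I -> chart M 'rV[R]_n)
    (f : I -> M -> R) (K : I -> set M),
  [/\ forall i, [/\ atlas (c i), closed (K i) & K i `<=` cdom (c i)],
      forall i, [/\ smooth_fun setT (f i), (forall q, 0 <= f i q) &
                    forall q, ~ K i q -> f i q = 0],
      forall p : M, exists2 N, open_nbhs p N & finite_set [set i | K i `&` N !=set0] &
      forall p, exists i, 0 < f i p].
Proof.
pose F1 := [set A : set M | open A /\ exists2 K, compact K & A `<=` K].
have [|G1 [oG1 cG1 KG1 lG1]] := pM (fun A (F1A : F1 A) => F1A.1).
  apply/seteqP; split => // p _.
  have [b [K [_ [ob bp] cK KA b0]]] := bump_exists hM openT (I : setT p).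
  exists [set q | 0 < b q] => //; split => //; exists K => // q /= bq.
  by apply: contrapT => /b0 b0q; rewrite b0q ltxx in bq.
pose P (D : set M) (y : set M * chart M 'rV[R]_n * (M -> R) * set M) :=
  let: (B, c, f, K) := y in
  [/\ G1 B, atlas c /\ closed K, K `<=` B `&` cdom c, smooth_fun setT f &
      (forall q, 0 <= f q) /\ (forall q, ~ K q -> f q = 0) /\ D `<=` [set q | 0 < f q]].
pose F2 := [set A : set M | open A /\ exists y, P A y].
have [|G2 [oG2 cG2 PG2 lG2]] := pM (fun A (F2A : F2 A) => F2A.1).
  apply/seteqP; split => // p _; have : setT p by [].
  rewrite -cG1 => -[B GB Bp].
  have [b [K [[sb bge0] [ob bp] cK KA b0]]] := bump_exists hM (oG1 _ GB) Bp.
  exists [set q | 0 < b q] => //; split => //.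
  exists (B, chart_at p, b, K); split => //; split => //.
  - exact: chart_at_atlas.
  - exact: compact_closed.
  - by split => //.
(* Indices are inhabited because local finiteness counts only the sets that meet a given compact
   set: a point of [D] lies in the positivity set of its bump, hence in the support, hence in the
   relatively compact member of [G1] around it. *)
pose G2' := [set D | G2 D /\ D !=set0].
have /choice[h hP] : forall D : G2', exists y, P (val D) y.
  move=> [D /= /set_mem[/PG2[A [_ [[[[B c] f] K] [? ? ? ? [? [? DA]]]]] DsA] _]].
  exists (B, c, f, K); split => //; split => //; split => //.
  exact: subset_trans DsA DA.
exists G2', (fun i => (h i).1.1.2), (fun i => (h i).1.2), (fun i => (h i).2); split.
- move=> i; have := hP i; case: (h i) => [[[B c] f] K] /= [? [? ?] KB ? _].
  by split => // x /KB[].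
- by move=> i; have := hP i; case: (h i) => [[[B c] f] K] /= [? [? ?] ? ? [? [? _]]].
- move=> p; have [N pN fN] := lG1 p.
  exists (interior N); first by split; [exact: open_interior|].
  pose J B := [set i : G2' | (h i).1.1.1 = B].
  apply: (@sub_finite_set _ _ (\bigcup_(B in [set B | G1 B /\ B `&` N !=set0]) J B)).
    move=> i [x [Kx /interior_subset Nx]]; exists (h i).1.1.1 => //.
    have := hP i; move: Kx; case: (h i) => [[[B c] f] K] /= Kx [GB _ KB _ _].
    by split => //; exists x; split => //; exact: (KB _ Kx).1.
  apply: bigcup_finite => // B [GB _].
  have [A [_ [K cK AK]] BA] := KG1 _ GB.
  have fK := compact_locally_finite cK lG2.
  apply: (@sub_finite_set _ _ ((val : G2' -> set M) @^-1` [set B | G2 B /\ B `&` K !=set0])).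
    move=> i iB /=; have [G2i [x ix]] := set_mem (valP i).
    split => //; exists x; split => //; apply/AK/BA.
    have := hP i; move: iB; rewrite /J /=.
    case: (h i) => [[[B' c] f] K'] /= -> [_ _ KB _ [_ [f0 Df]]].
    have fx := Df _ ix; apply: (KB x _).1; apply: contrapT => /f0 fx0.
    by move: fx; rewrite /= fx0 ltxx.
  by apply: finite_preimage => //; apply: in2W; exact: val_inj.
- move=> p; have : setT p by [].
  rewrite -cG2 => -[D G2D Dp].
  have D2 : D \in G2' by apply/mem_set; split => //; exists p.
  exists (exist _ D D2 : G2').
  have := hP (exist _ D D2 : G2'); case: (h _) => [[[B c] f] K] /= [_ _ _ _ [_ [_ ]]].
  exact.
Qed.

Lemma partition_of_unity : exists (I : choiceType) (c : I -> chart M 'rV[R]_n)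
    (rho : I -> M -> R) (K : I -> set M),
  [/\ forall i, [/\ atlas (c i), closed (K i) & K i `<=` cdom (c i)],
      forall i, smooth_fun setT (rho i) /\ (forall q, ~ K i q -> rho i q = 0),
      forall p : M, exists2 N, open_nbhs p N & finite_set [set i | K i `&` N !=set0] &
      forall p, \sum_(i \in setT) rho i p = 1].
Proof.
have [I [c [f [K [cK fK lf fpos]]]]] := locally_finite_bumps.
pose F p := \sum_(i \in setT) f i p.
(* On [N] the sum runs over one fixed finite index set, from which the smoothness and the positivity
   of [F] are read off. *)
have locF p N : finite_set [set i | K i `&` N !=set0] -> N p ->
    F p = \sum_(i <- finmap.enum_fset (fset_set [set i | K i `&` N !=set0])) f i p.
  move=> fN Np; rewrite -fsbig_finite//; apply/esym/fsbig_widen => // i [_ /= Ki].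
  by have [_ _] := fK i; apply=> Kp; apply: Ki; exists p.
have F0 p : 0 < F p.
  have [N [oN Np] fN] := lf p; rewrite (locF p N)//.
  have [i fi] := fpos p; have Ki : K i p.
    by apply: contrapT => nK; have [_ _ f0] := fK i; rewrite f0// ltxx in fi.
  rewrite (big_rem i)/=; last by rewrite in_fset_set// inE; exists p.
  by rewrite ltr_pwDl// sumr_ge0// => j _; have [_ + _] := fK j; apply.
have sF : smooth_fun setT F.
  apply: smooth_fun_local => p _; have [N [oN Np] fN] := lf p.
  exists N; split => //.
  apply: (eq_smooth_fun oN (f := fun q =>
    \sum_(i <- finmap.enum_fset (fset_set [set i | K i `&` N !=set0])) f i q)).
    by move=> q Nq; rewrite (locF q N).
  apply: smooth_fun_sum => // i _; have [sf _ _] := fK i.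
  exact: smooth_fun_subset sf.
exists I, c, (fun i p => f i p * (F p)^-1), K; split => //.
- move=> i; have [sf _ f0] := fK i; split; last by move=> q Kq; rewrite f0// mul0r.
  apply: smooth_funM => //; first exact: openT.
  by apply: smooth_funV => //; [exact: openT|move=> p _; rewrite gt_eqF].
- move=> p; have [N [oN Np] fN] := lf p.
  have -> : \sum_(i \in setT) f i p * (F p)^-1 =
      \sum_(i <- finmap.enum_fset (fset_set [set i | K i `&` N !=set0])) f i p * (F p)^-1.
    rewrite -fsbig_finite//; apply/esym/fsbig_widen => // i [_ /= Ki].
    have [_ _ f0] := fK i; rewrite f0 ?mul0r// => Kp; apply: Ki; exists p.
    by split.
  by rewrite -big_distrl/= -(locF p N)// divff// gt_eqF.
Qed.

End PartitionOfUnity.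

(** * Derivatives of bi-forms on the diagonal *)

Section SecondOrder.
Variables (R : realType) (V : normedModType R) (N : manifold V).
Hypothesis fV : findim V.
Variables (A : set N) (p : N) (J : finType) (xi W : J -> N -> R) (X Z : N -> V).
Hypotheses (oA : open A) (Ap : A p).
Hypotheses (sxi : forall j, smooth_fun A (xi j)) (sW : forall j, smooth_fun A (W j)).
Hypotheses (sX : smooth_field X) (sZ : smooth_field Z).

(** The 1-form sum_j W_j dxi_j contracted with [Y]. Later [xi] are chart coordinates centred at [p]
    and [W] the components of w(., p) in the coordinate frame. *)
Let pairing (Y : N -> V) (x : N) := \sum_j lie Y (xi j) x * W j x.

Lemma lie_pairing (Y Y' : N -> V) : smooth_field Y ->
  lie Y' (pairing Y) p =
  \sum_j (lie Y (xi j) p * lie Y' (W j) p + W j p * lie Y' (lie Y (xi j)) p).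
Proof.
move=> sY; rewrite /lie (tderiv_sum Ap)//.
  apply: eq_bigr => j _; rewrite (tderivM Ap (A := A))//.
  exact: smooth_lie.
by move=> j _; apply: smooth_funM => //; exact: smooth_lie.
Qed.

Let trapezoid (x : N) := \sum_j 2^-1 * (xi j x * (W j x + W j p)).

Lemma lie_trapezoid (Y : N -> V) (x : N) : A x ->
  lie Y trapezoid x =
  \sum_j 2^-1 * (xi j x * lie Y (W j) x + (W j x + W j p) * lie Y (xi j) x).
Proof.
move=> Ax.
have sWp j : smooth_fun A (fun x => W j x + W j p).
  by apply: (smooth_funD oA) => //; exact: smooth_fun_cst.
have sxW j : smooth_fun A (fun x => xi j x * (W j x + W j p)).
  exact: smooth_funM.
rewrite /lie (tderiv_sum Ax)//; last first.
  by move=> j _; apply: (smooth_funM oA) => //; exact: smooth_fun_cst.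
apply: eq_bigr => j _.
rewrite (tderivM Ax _ (smooth_fun_cst A 2^-1) (sxW j)) tderiv_cst mulr0 addr0.
congr (_ * _); rewrite (tderivM Ax _ (sxi j) (sWp j)).
by rewrite (tderivD Ax _ (sW j) (smooth_fun_cst A (W j p))) tderiv_cst addr0.
Qed.

Hypothesis xi0 : forall j, xi j p = 0.

(** Since [xi j] vanishes at [p], only its own derivative survives, multiplied by the mean of two
    equal values [W j p]. *)
Lemma tderiv_trapezoid (v : V) :
  tderiv p v trapezoid = \sum_j tderiv p v (xi j) * W j p.
Proof.
rewrite [LHS](lie_trapezoid (fun=> v) Ap); apply: eq_bigr => j _.
rewrite xi0 mul0r add0r /lie.
by move: (tderiv p v (xi j)) (W j p) => *; field.
Qed.

(** The premise says that the 1-form sum_j W_j dxi_j is closed at [p] on the pair (Z, X). The defect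
    in the conclusion is half of its exterior derivative, up to sign. *)
Lemma lie_lie_trapezoid :
  lie Z (pairing X) p - lie X (pairing Z) p =
    \sum_j tderiv p (bracket Z X p) (xi j) * W j p ->
  lie Z (lie X trapezoid) p = lie Z (pairing X) p.
Proof.
have sl (f : N -> R) Y : smooth_field Y -> smooth_fun A f -> smooth_fun A (lie Y f).
  by move=> sY sf; exact: smooth_lie.
rewrite !lie_pairing// -sumrB => H.
(* The second derivatives of [xi j] cancel against the bracket term, leaving the sum of the (dxi_j ^
   dW_j)(Z, X). *)
have {}H : \sum_j (lie Z (xi j) p * lie X (W j) p - lie X (xi j) p * lie Z (W j) p) = 0.
  apply/eqP; rewrite -oppr_eq0 -sumrN; apply/eqP.
  rewrite -[RHS](subrr (\sum_j tderiv p (bracket Z X p) (xi j) * W j p)).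
  rewrite -[in X in _ = X - _]H -sumrB; apply: eq_bigr => j _.
  rewrite (lie_bracket fV oA Ap sX sZ (sxi j)).
  move: (lie Z (lie X (xi j)) p) (lie X (lie Z (xi j)) p) (lie Z (xi j) p)
    (lie X (xi j) p) (lie X (W j) p) (lie Z (W j) p) (W j p) => *; ring.
have -> : lie Z (lie X trapezoid) p =
    lie Z (fun x => \sum_j 2^-1 *
      (xi j x * lie X (W j) x + (W j x + W j p) * lie X (xi j) x)) p.
  by apply: (eq_tderiv Ap) => // x Ax; exact: lie_trapezoid.
have sWp j : smooth_fun A (fun x => W j x + W j p).
  by apply: (smooth_funD oA) => //; exact: smooth_fun_cst.
have s1 j : smooth_fun A (fun x => xi j x * lie X (W j) x).
  by apply: (smooth_funM oA) => //; exact: sl.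
have s2 j : smooth_fun A (fun x => (W j x + W j p) * lie X (xi j) x).
  by apply: (smooth_funM oA) => //; exact: sl.
have s3 j : smooth_fun A (fun x => xi j x * lie X (W j) x + (W j x + W j p) * lie X (xi j) x).
  exact: (smooth_funD oA).
rewrite {1}/lie (tderiv_sum Ap)//; last first.
  by move=> j _; apply: (smooth_funM oA) => //; exact: smooth_fun_cst.
(* The second derivative of the trapezoid exceeds that of the pairing by half of the sum shown to
   vanish. *)
transitivity (\sum_j (lie X (xi j) p * lie Z (W j) p + W j p * lie Z (lie X (xi j)) p) +
    2^-1 * \sum_j (lie Z (xi j) p * lie X (W j) p - lie X (xi j) p * lie Z (W j) p));
  last by rewrite H mulr0 addr0.
rewrite mulr_sumr -big_split; apply: eq_bigr => j _ /=.
rewrite (tderivM Ap _ (smooth_fun_cst A 2^-1) (s3 j)) tderiv_cst mulr0 addr0.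
rewrite (tderivD Ap _ (s1 j) (s2 j)).
rewrite (tderivM Ap _ (sxi j) (sl _ _ sX (sW j))).
rewrite (tderivM Ap _ (sWp j) (sl _ _ sX (sxi j))).
rewrite (tderivD Ap _ (sW j) (smooth_fun_cst A (W j p))) tderiv_cst addr0.
have lieE (f : N -> R) : tderiv p (Z p) f = lie Z f p by [].
rewrite xi0 mul0r add0r !lieE /cst.
by move: (lie Z (lie X (xi j)) p) (lie Z (xi j) p)
  (lie X (xi j) p) (lie X (W j) p) (lie Z (W j) p) (W j p) => *; field.
Qed.

End SecondOrder.

(** The Gram matrix of a nondegenerate form has trivial left kernel and is therefore invertible. No
    positivity enters, so indefinite metrics are covered. *)
Lemma riesz_nondegenerate (R : realType) n (g : 'rV[R]_n -> 'rV[R]_n -> R)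
    (l : 'rV[R]_n -> R) :
  bilinear2 g -> (forall v, (forall w, g v w = 0) -> v = 0) -> scalar l ->
  exists v, forall w, g v w = l w.
Proof.
move=> [gl gr] g0 ll.
pose lm (f : 'rV[R]_n -> R) (lf : scalar f) : {linear 'rV[R]_n -> R} := linear_map lf.
have lsum (f : 'rV[R]_n -> R) (lf : scalar f) w : f w = \sum_j w 0 j * f (delta_mx 0 j).
  have -> : f w = lm f lf w by [].
  rewrite {1}[w]row_sum_delta linear_sum.
  by apply: eq_bigr => j _; rewrite linearZ.
pose G : 'M[R]_n := \matrix_(i, j) g (delta_mx 0 i) (delta_mx 0 j).
have gE v j : g v (delta_mx 0 j) = (v *m G) 0 j.
  by rewrite (lsum (g^~ _) (gr _)) mxE; apply: eq_bigr => i _; rewrite mxE.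
have Gu : G \in unitmx.
  rewrite -row_free_unit; apply: inj_row_free => v vG0; apply: g0 => w.
  by rewrite (lsum _ (gl v)) big1// => j _; rewrite gE vG0 mxE mulr0.
exists ((\row_j l (delta_mx 0 j)) *m invmx G) => w.
rewrite (lsum _ (gl _)) [RHS](lsum _ ll); apply: eq_bigr => j _.
by rewrite gE mulmxKV// mxE.
Qed.

(** * Bi-forms with the second point frozen *)

Section BiFormSlices.
Variables (R : realType) (V : normedModType R) (M : manifold V).
Hypothesis fV : findim V.
Local Notation MM := (prod_manifold M M).
Implicit Types (c d : chart M V).

Lemma open_slice (U : set MM) (y : M) : open U -> open [set x : M | U (x, y)].
Proof.
move=> oU; apply: (@open_comp _ _ (fun x : M => (x, y)) U) => // x _.
by apply: (@cvg_pair _ _ _ _ (nbhs _) (nbhs _)) => /=; [exact: cvg_id|exact: cst_continuous].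
Qed.

Lemma open_fst (A : set M) : open A -> open [set p : MM | A p.1].
Proof.
by move=> oA; apply: (@open_comp _ _ (fun p : M * M => p.1)) => // x _; exact: cvg_fst.
Qed.

Lemma open_snd (A : set M) : open A -> open [set p : MM | A p.2].
Proof.
by move=> oA; apply: (@open_comp _ _ (fun p : M * M => p.2)) => // x _; exact: cvg_snd.
Qed.

(** The fixed vector [v] at [y] equals [frame (chart_at y) y v], so the slice restricts a component
    whose smoothness is given. *)
Lemma smooth_slice01 (U : set MM) (S : biform01 M) (y : M) (v : V) : open U ->
  (forall d v, atlas d ->
     smooth_fun (U `&` (setT `*` cdom d)) (fun p : MM => S p (frame d p.2 v))) ->
  smooth_fun [set x : M | U (x, y)] (fun x => S (x, y) v).
Proof.
move=> oU /(_ (chart_at y) v (chart_at_atlas y)) sS.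
have oB : open (U `&` (setT `*` cdom (chart_at y)) : set MM).
  by apply: openI => //; apply: openX; [exact: openT|exact: open_cdom].
have := smooth_slice fV y oB sS; rewrite /= frame_chart_at.
by apply: smooth_fun_subset => x Ux; split => //; split => //; exact: chart_at_dom.
Qed.

Lemma smooth_slice11 (U : set MM) (w : biform11 M) c (y : M) (u v : V) : open U ->
  (forall c d u v, atlas c -> atlas d ->
          smooth_fun (U `&` (cdom c `*` cdom d))
            (fun p : MM => w p (frame c p.1 u) (frame d p.2 v))) -> atlas c ->
  smooth_fun [set x : M | U (x, y) /\ cdom c x] (fun x => w (x, y) (frame c x u) v).
Proof.
move=> oU sw ac.
have oB : open (U `&` (cdom c `*` cdom (chart_at y)) : set MM).
  by apply: openI => //; apply: openX; exact: open_cdom.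
have := smooth_slice fV y oB (sw c (chart_at y) u v ac (chart_at_atlas y)).
rewrite /= frame_chart_at; apply: smooth_fun_subset => x [Ux cx].
by split => //; split => //; exact: chart_at_dom.
Qed.

Lemma dL_biform11 (S : biform01 M) : local_biform01 S -> local_biform11 (dL S).
Proof.
move=> [U [[oU dU] lS sS]]; exists U; split => //.
- move=> p Up; have pE : p = (p.1, p.2) by case: p {Up}.
  have sl v := smooth_slice01 p.2 v oU sS.
  have Up' : [set x : M | U (x, p.2)] p.1 by rewrite /= -pE.
  split => [v|v]; last by exact: (tderiv_is_linear Up' (sl v)).
  move=> a y z; rewrite /dL.
  rewrite (@eq_tderiv _ _ _ _ _ Up' _ _
    (fun x => a * S (x, p.2) y + S (x, p.2) z) (open_slice p.2 oU)); last first.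
    by move=> x Ux; exact: (lS _ Ux).
  rewrite (tderivD Up')//; last first.
    by apply: smooth_funM => //; [exact: open_slice|exact: smooth_fun_cst].
  by rewrite (tderivM Up' _ (smooth_fun_cst _ a) (sl y)) tderiv_cst mulr0 addr0.
- move=> c d u v ac ad.
  have oB : open (U `&` (cdom c `*` cdom d) : set MM).
    by apply: openI => //; apply: openX; exact: open_cdom.
  have acd := atlas_prod ac ad.
  apply: (smooth_fun_chart (findim_prod fV fV) acd oB); first by move=> p [].
  (* In a product chart, the left derivative of a component of [S] is its directional derivative
     along [(u, 0)]; it costs one order of differentiability. *)
  move=> k; have [_ /(_ (u, 0))] := sS d v ad _ acd k.+1.
  move=> /(@Ck_subset _ _ _ k _ (ccod (prod_chart c d) `&`
     cinv (prod_chart c d) @^-1` (U `&` (cdom c `*` cdom d)))) H.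
  have {}H := H _; apply: eq_Ck (H _).
  + exact: open_chart_preimage.
  + move=> [a b] [[/= ca db] [Uab _]].
    have cda : cdom c (cinv c a) by exact: cinv_dom.
    rewrite /dL (tderiv_frame (A := [set x : M | U (x, cinv d b)]) _ _ ac)//; last first.
      exact: smooth_slice01.
    rewrite /= cinvK//; rewrite /derive /=; set F := (X in lim (X @ _)).
    set G := (X in _ = lim (X @ _)); suff -> : F = G by [].
    by rewrite {}/F {}/G; apply/funext => h /=; rewrite scaler0 add0r.
  + by move=> x [cx [Ux [_ dx]]].
Qed.

End BiFormSlices.

(** * The potential of a contrast bi-form *)

Section Construction.
Variables (R : realType) (n : nat) (M : manifold 'rV[R]_n).
Local Notation V := 'rV[R]_n.
Local Notation MM := (prod_manifold M M).
Variables (w : biform11 M) (U : set MM).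
Hypotheses (oU : open U) (dU : forall m : M, U (m, m)).
Hypothesis lw : forall p, U p -> bilinear2 (w p).
Hypothesis sw : forall c d u v, atlas c -> atlas d ->
  smooth_fun (U `&` (cdom c `*` cdom d))
    (fun p : MM => w p (frame c p.1 u) (frame d p.2 v)).
Implicit Types (c d : chart M V).

Let fV : findim V := findim_rV R n.

Definition rv_coord (j : 'I_n) (x : V) : R := x 0 j.

Lemma rv_coord_linear j : linear (rv_coord j).
Proof. by move=> a x y; rewrite /rv_coord !mxE. Qed.

Lemma rv_coord_continuous j : continuous (rv_coord j).
Proof. by move=> x; exact: coord_continuous. Qed.

(** The coordinates of the chart [c] centred at [y], written as a sum with an opposite so that the
    rules for sums apply directly. *)
Definition coord_diff c (y : M) (j : 'I_n) (x : M) : R := rv_coord j (c x) + - rv_coord j (c y).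

Lemma smooth_rv_coord c j : atlas c -> smooth_fun (cdom c) (fun x : M => rv_coord j (c x)).
Proof.
move=> ac; apply: (@smooth_fun_coord _ _ _ c (linear_map (rv_coord_linear j))) => //.
exact: rv_coord_continuous.
Qed.

Lemma smooth_coord_diff c y j : atlas c -> smooth_fun (cdom c) (coord_diff c y j).
Proof.
move=> ac; apply: smooth_funD; [exact: open_cdom|exact: smooth_rv_coord|exact: smooth_fun_cst].
Qed.

Lemma tderiv_coord_diff c y j x v : atlas c -> cdom c x ->
  tderiv x v (coord_diff c y j) = rv_coord j (coords c x v).
Proof.
move=> ac cx; rewrite (tderivD cx v (smooth_rv_coord j ac) (smooth_fun_cst _ _)).
rewrite tderiv_cst addr0 /coords /tderiv.
have dc : differentiable (c \o cinv (chart_at x)) (chart_at x x).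
  by apply: transition_differentiable => //; [exact: chart_at_atlas|exact: chart_at_dom].
have dl z : differentiable (rv_coord j) z.
  apply: (@linear_differentiable _ _ _ (linear_map (rv_coord_linear j))).
  exact: rv_coord_continuous.
have := @derive_comp _ _ _ _ (c \o cinv (chart_at x)) (rv_coord j) (chart_at x x) v dc (dl _).
move=> ->; rewrite deriveE//.
by rewrite (@diff_lin _ _ _ (linear_map (rv_coord_linear j)))//; exact: rv_coord_continuous.
Qed.

Lemma scalar_sum (I : Type) (r : seq I) (f : V -> R) (a : I -> R) (v : I -> V) :
  scalar f -> f (\sum_(i <- r) a i *: v i) = \sum_(i <- r) a i * f (v i).
Proof.
move=> lf; have -> : f = linear_map (lf : linear f) by [].
by rewrite linear_sum; apply: eq_bigr => i _; rewrite linearZ.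
Qed.

(** The components of [v] in [c] are the derivatives of the centred coordinates along [v]. Hence
    w(., y)(. | u) has the form sum_j W_j dxi_j required by the trapezoid lemmas. *)
Lemma biform_frame c y x v u : atlas c -> cdom c x -> U (x, y) ->
  w (x, y) v u =
  \sum_j tderiv x v (coord_diff c y j) * w (x, y) (frame c x (delta_mx 0 j)) u.
Proof.
move=> ac cx Uxy; rewrite -{1}(coordsK ac cx v).
rewrite [coords c x v in LHS]row_sum_delta.
have -> : frame c x (\sum_j coords c x v 0 j *: delta_mx 0 j) =
    \sum_j coords c x v 0 j *: frame c x (delta_mx 0 j).
  have -> : frame c x = linear_map (frame_is_linear ac cx) by [].
  by rewrite linear_sum; apply: eq_bigr => j _; rewrite linearZ.
rewrite (@scalar_sum _ _ ((w (x, y))^~ u)); last exact: (lw Uxy).2.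
by apply: eq_bigr => j _; rewrite tderiv_coord_diff.
Qed.

Lemma smooth_component c y j u : atlas c ->
  smooth_fun [set x : M | U (x, y) /\ cdom c x]
    (fun x => w (x, y) (frame c x (delta_mx 0 j)) u).
Proof. by move=> ac; exact: (smooth_slice11 fV). Qed.

Lemma open_slice_dom c (y : M) : open [set x : M | U (x, y) /\ cdom c x].
Proof. by apply: openI; [exact: open_slice|exact: open_cdom]. Qed.

Lemma contraction_sum c y X u x : atlas c -> [set x : M | U (x, y) /\ cdom c x] x ->
  w (x, y) (X x) u =
  \sum_j lie X (coord_diff c y j) x * w (x, y) (frame c x (delta_mx 0 j)) u.
Proof. by move=> ac [Uxy cx]; exact: biform_frame. Qed.

Lemma smooth_contraction c y X u : atlas c -> smooth_field X ->
  smooth_fun [set x : M | U (x, y) /\ cdom c x] (fun x => w (x, y) (X x) u).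
Proof.
move=> ac sX; apply: eq_smooth_fun (open_slice_dom c y) _ _.
  by move=> x Ax; rewrite (contraction_sum _ _ ac Ax).
apply: smooth_fun_sum => [|j _]; first exact: open_slice_dom.
apply: smooth_funM; [exact: open_slice_dom| |exact: smooth_component].
apply: (smooth_fun_subset (A := cdom c)); first by move=> x [].
by apply: smooth_lie => //; [exact: open_cdom|exact: smooth_coord_diff].
Qed.

(* Nondegeneracy makes the set in the [xget] of [conn] nonempty: the right-hand
   side depends linearly on the value [Y m] alone. *)
Lemma metric_conn (Z X Y : M -> V) (m : M) : pseudo_riemannian (metric w) ->
  smooth_field Z -> smooth_field X -> smooth_field Y ->
  metric w m (conn w Z X m) (Y m) = tderiv m (Z m) (fun x => w (x, m) (X x) (Y m)).
Proof.
move=> [bg _ ndg _] sZ sX sY.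
(* The bracket terms cancel, and the left derivative does not move the second point, so [T] enters
   only through the vector [T m]. *)
have lieLE T : lieL Z w X T (m, m) + metric w m (bracket Z X m) (T m) =
    tderiv m (Z m) (fun x => w (x, m) (X x) (T m)).
  by rewrite /lieL lie_liftL /= /eval11 /metric /diag11 /= subrK.
pose c := chart_at m.
have ac : atlas c by exact: chart_at_atlas.
have Am : [set x : M | U (x, m) /\ cdom c x] m by split; [exact: dU|exact: chart_at_dom].
have oA := open_slice_dom c m.
have sl : scalar (fun u => tderiv m (Z m) (fun x => w (x, m) (X x) u)).
  move=> a u v.
  rewrite (@eq_tderiv _ _ _ _ _ Am _ _
     (fun x => a * w (x, m) (X x) u + w (x, m) (X x) v) oA); last first.
    by move=> x [Ux _]; exact: ((lw Ux).1 (X x)).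
  have s1 := smooth_contraction m u ac sX; have s2 := smooth_contraction m v ac sX.
  rewrite (tderivD Am _ _ s2); last first.
    by apply: smooth_funM => //; exact: smooth_fun_cst.
  by rewrite (tderivM Am _ (smooth_fun_cst _ a) s1) tderiv_cst mulr0 addr0.
have [v gv] := riesz_nondegenerate (bg m) (ndg m) sl.
have : [set v | forall Y, smooth_field Y -> metric w m v (Y m) =
    lieL Z w X Y (m, m) + metric w m (bracket Z X m) (Y m)] v.
  by move=> T sT; rewrite lieLE gv.
by move=> /(xgetI 0) /(_ Y sY); rewrite lieLE.
Qed.

(** * Gluing the local potentials near the diagonal *)

Section Gluing.
Variables (I : choiceType) (c : I -> chart M V) (rho : I -> M -> R) (K : I -> set M).
Hypothesis cK : forall i, [/\ atlas (c i), closed (K i) & K i `<=` cdom (c i)].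
Hypothesis srho : forall i, smooth_fun setT (rho i) /\ (forall q, ~ K i q -> rho i q = 0).
Hypothesis lfK : forall p : M, exists2 N, open_nbhs p N &
  finite_set [set i | K i `&` N !=set0].
Hypothesis rho1 : forall p, \sum_(i \in setT) rho i p = 1.

(* Trapezoidal rule for the line integral of [w (. , y)] from [y] to [x] along
   the segment of the chart [c]. *)
Definition local_potential (c : chart M V) : biform01 M := fun p Y =>
  \sum_j 2^-1 * (coord_diff c p.2 j p.1 *
     (w p (frame c p.1 (delta_mx 0 j)) Y +
      w (p.2, p.2) (frame c p.2 (delta_mx 0 j)) Y)).

Definition potential : biform01 M := fun p Y =>
  \sum_(i \in setT) rho i p.2 * local_potential (c i) p Y.

(** On [N] times [N] the glued potential is one finite sum. The last clause is needed because the
    weights see only y: a chart with nonzero weight at y must also be defined at x, which may lie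
    outside [K i]. *)
Definition adapted (N : set M) := [/\ open N, forall x y, N x -> N y -> U (x, y),
  finite_set [set i | K i `&` N !=set0] & forall i, K i `&` N !=set0 -> N `<=` cdom (c i)].

Lemma adapted_nbhd (m : M) : exists2 N, adapted N & N m.
Proof.
have [N1 [oN1 N1m] fN1] := lfK m.
have [[A B] /= [mA mB] ABU] : nbhs (m, m) U by exact: open_nbhs_nbhs.
pose J := [set i | K i `&` N1 !=set0].
(* Near [m], either stay in the chart, if its support contains [m], or avoid the closed support
   altogether; only the finitely many indices in [J] have to be treated. *)
pose C i := [set x : M | (K i m -> cdom (c i) x) /\ (~ K i m -> ~ K i x)].
have mC i : nbhs m (C i).
  have [_ clK Kc] := cK i; have [Km|nKm] := pselect (K i m).
    have : nbhs m (cdom (c i)).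
      by apply: open_nbhs_nbhs; split; [exact: open_cdom|exact: Kc].
    by apply: filterS => x cx; split.
  have : nbhs m (~` K i) by apply: open_nbhs_nbhs; split => //; exact: closed_openC.
  by apply: filterS => x cx; split.
have mCJ : nbhs m (\bigcap_(i in J) C i).
  rewrite /J -(fset_setK fN1); exact: filter_bigI.
pose N := interior (A `&` B `&` N1 `&` \bigcap_(i in J) C i).
exists N.
  split; first exact: open_interior.
  - move=> x y /interior_subset[[[Ax _] _] _] /interior_subset[[[_ By] _] _].
    exact: (ABU (x, y)).
  - apply: sub_finite_set fN1 => i [x [Kx /interior_subset[[_ N1x] _]]].
    by exists x.
  - move=> i [x [Kx /interior_subset[[_ N1x] Cx]]] y /interior_subset[_ Cy].
    have Ji : J i by exists x.
    have [Km|nKm] := pselect (K i m); first exact: (Cy i Ji).1.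
    by have := (Cx i Ji).2 nKm Kx.
rewrite /N; apply: nbhs_singleton; apply: nbhs_interior.
by do !apply: filterI => //; exact: open_nbhs_nbhs.
Qed.

Let ind (N : set M) := finmap.enum_fset (fset_set [set i | K i `&` N !=set0]).

Lemma sum_adapted (N : set M) (y : M) (f : I -> R) : adapted N -> N y ->
  \sum_(i \in setT) rho i y * f i = \sum_(i <- ind N) rho i y * f i.
Proof.
move=> [_ _ fN _] Ny; rewrite /ind -fsbig_finite//; apply/esym/fsbig_widen => // i [_ /= Ki].
by have [_ r0] := srho i; rewrite r0 ?mul0r// => Kp; apply: Ki; exists y.
Qed.

Lemma ind_dom (N : set M) i : adapted N -> i \in ind N -> N `<=` cdom (c i).
Proof. by move=> [_ _ fN NK]; rewrite /ind in_fset_set// => /set_mem /NK. Qed.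

Lemma sum_rho_adapted (N : set M) (y : M) : adapted N -> N y ->
  \sum_(i <- ind N) rho i y = 1.
Proof.
move=> aN Ny; transitivity (\sum_(i <- ind N) rho i y * 1).
  by apply: eq_bigr => i _; rewrite mulr1.
rewrite -(sum_adapted (fun=> 1) aN Ny) -[RHS](rho1 y).
by apply: eq_fsbigr => i _; rewrite mulr1.
Qed.

Lemma smooth_local_potential (N : set M) (e d : chart M V) (v : V) : atlas e -> atlas d ->
  adapted N -> N `<=` cdom e ->
  smooth_fun [set p : MM | N p.1 /\ (N `&` cdom d) p.2]
    (fun p : MM => local_potential e p (frame d p.2 v)).
Proof.
move=> ae ad [oN NU _ _] Ne; set B := (X in smooth_fun X).
have oNd : open (N `&` cdom d) by apply: openI => //; exact: open_cdom.
have oB : open B by apply: openI; [exact: open_fst|exact: open_snd].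
apply: smooth_fun_sum => // j _; apply: smooth_funM => //; first exact: smooth_fun_cst.
apply: smooth_funM => //.
  apply: smooth_funD => //.
    apply: (smooth_fun_subset (A := [set p : MM | N p.1])); first by move=> p [].
    apply: (smooth_fst fV oN (f := fun x => rv_coord j (e x))).
    exact: smooth_fun_subset (smooth_rv_coord j ae).
  have : smooth_fun B (fun p : MM => -1 * rv_coord j (e p.2)).
    apply: smooth_funM => //; first exact: smooth_fun_cst.
    apply: (smooth_fun_subset (A := [set p : MM | N p.2])); first by move=> p [_ []].
    apply: (smooth_snd fV oN (f := fun y => rv_coord j (e y))).
    exact: smooth_fun_subset (smooth_rv_coord j ae).
  by apply: eq_smooth_fun => // p _; rewrite mulN1r.
apply: smooth_funD => //.
  apply: smooth_fun_subset (sw (delta_mx 0 j) v ae ad) => p [N1 [N2 d2]].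
  by split; [case: p N1 N2 {d2} => p1 p2; exact: NU|split => //; exact: Ne].
apply: (smooth_fun_subset (A := [set p : MM | (N `&` cdom d) p.2])); first by move=> p [].
apply: (smooth_snd fV oNd (f := fun y => w (y, y) (frame e y (delta_mx 0 j)) (frame d y v))).
have oE : open (U `&` (cdom e `*` cdom d) : set MM).
  by apply: openI => //; apply: openX; exact: open_cdom.
apply: smooth_fun_subset (smooth_diag fV oE (sw (delta_mx 0 j) v ae ad)).
by move=> y [Ny dy]; split; [exact: dU|split => //; exact: Ne].
Qed.

Lemma potential_local : local_biform01 potential.
Proof.
(* The domain of the potential is the union of the squares of adapted sets, a neighbourhood of the
   diagonal on which each point has a finite-sum formula. *)
pose D := [set p : MM | exists2 N, adapted N & N p.1 /\ N p.2].
exists D; split.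
- split; last by move=> m; have [N aN Nm] := adapted_nbhd m; exists N.
  rewrite openE => p [N aN [N1 N2]]; have [oN _ _ _] := aN.
  exists (N, N); first by split; apply: open_nbhs_nbhs.
  by move=> q [q1 q2]; exists N.
- move=> p [N aN [N1 N2]] a u v; have [_ NU _ _] := aN.
  rewrite /potential !(sum_adapted _ aN N2) mulr_sumr -big_split/=.
  apply: eq_bigr => i _; rewrite mulrCA -mulrDr; congr (_ * _).
  rewrite /local_potential mulr_sumr -big_split/=; apply: eq_bigr => j _.
  have Up : U p by case: p N1 N2 => p1 p2; exact: NU.
  rewrite (lw Up).1 (lw (dU p.2)).1.
  move: (coord_diff _ _ _ _) (w p _ _) (w p _ _).
  by move: (w (p.2, p.2) _ _) (w (p.2, p.2) _ _) => *; ring.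
- move=> d v ad; apply: smooth_fun_local => p [[N aN [N1 N2]] [_ d2]].
  have [oN NU _ NK] := aN.
  exists ([set p : MM | N p.1 /\ (N `&` cdom d) p.2]).
  have oB : open ([set p : MM | N p.1 /\ (N `&` cdom d) p.2]).
    apply: openI; [exact: open_fst|apply: open_snd; apply: openI => //; exact: open_cdom].
  split => //.
  apply: (eq_smooth_fun oB (f := fun p : MM => \sum_(i <- ind N | i \in ind N)
    rho i p.2 * local_potential (c i) p (frame d p.2 v))).
    by move=> q [q1 [q2 _]]; rewrite /potential (sum_adapted _ aN q2) -big_seq.
  apply: smooth_fun_sum => // i iN; apply: smooth_funM => //.
    apply: (smooth_fun_subset (A := setT)) => //.
    by apply: (smooth_snd fV openT); exact: (srho i).1.
  apply: smooth_local_potential => //; last exact: (ind_dom aN).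
  by have [] := cK i.
Qed.

Lemma potential_diag m v : diag01 potential m v = 0.
Proof.
rewrite /diag01 /potential; apply: fsbig1 => i _.
by rewrite /local_potential big1 ?mulr0// => j _; rewrite /coord_diff/= subrr mul0r mulr0.
Qed.

Section AtDiagonal.
Variables (m : M) (Y : V) (N : set M).
Hypotheses (aN : adapted N) (Nm : N m).

Let L i (x : M) := local_potential (c i) (x, m) Y.
Let W i j (x : M) := w (x, m) (frame (c i) x (delta_mx 0 j)) Y.

Lemma adapted_open : open N. Proof. by case: aN. Qed.

Lemma smooth_coord_diff_adapted i j : i \in ind N -> smooth_fun N (coord_diff (c i) m j).
Proof.
move=> iN; apply: smooth_fun_subset (ind_dom aN iN) _.
by apply: smooth_coord_diff; have [] := cK i.
Qed.

Lemma smooth_component_adapted i j : i \in ind N -> smooth_fun N (W i j).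
Proof.
move=> iN; apply: smooth_fun_subset (smooth_component m j Y _); last by have [] := cK i.
move=> x Nx; split; last exact: (ind_dom aN).
by have [_ NU _ _] := aN; exact: NU.
Qed.

Lemma coord_diff_diag i j : coord_diff (c i) m j m = 0.
Proof. by rewrite /coord_diff subrr. Qed.

Lemma smooth_local_potential_slice i : i \in ind N -> smooth_fun N (L i).
Proof.
move=> iN; have oN := adapted_open; apply: smooth_fun_sum => // j _.
apply: smooth_funM => //; first exact: smooth_fun_cst.
apply: smooth_funM => //; first exact: smooth_coord_diff_adapted.
apply: smooth_funD => //; first exact: smooth_component_adapted.
exact: (smooth_fun_cst N (W i j m)).
Qed.

(** The repeated condition [i \in ind N] hands membership to the side conditions of the lemmas on
    sums. *)
Lemma potentialE (x : M) : potential (x, m) Y = \sum_(i <- ind N | i \in ind N) rho i m * L i x.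
Proof. by rewrite /potential (sum_adapted _ aN Nm) -big_seq. Qed.

Lemma tderiv_potential (x : M) (v : V) : N x ->
  tderiv x v (fun z => potential (z, m) Y) =
  \sum_(i <- ind N | i \in ind N) rho i m * tderiv x v (L i).
Proof.
move=> Nx; under [X in tderiv x v X = _]eq_fun do rewrite potentialE.
have oN := adapted_open.
rewrite (tderiv_sum Nx)//; last first.
  move=> i iN; apply: smooth_funM => //; first exact: smooth_fun_cst.
  exact: smooth_local_potential_slice.
apply: eq_bigr => i iN.
rewrite (tderivM Nx _ (smooth_fun_cst _ _) (smooth_local_potential_slice iN)).
by rewrite tderiv_cst mulr0 addr0.
Qed.

Lemma metric_potential (v : V) : metric (dL potential) m v Y = metric w m v Y.
Proof.
rewrite /metric /diag11 /dL/= tderiv_potential//.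
rewrite -[RHS]mul1r -(sum_rho_adapted aN Nm) mulr_suml big_seq.
apply: eq_bigr => i iN; congr (_ * _).
have [ai _ _] := cK i.
rewrite [RHS](biform_frame v Y ai (ind_dom aN iN Nm) (dU m)).
apply: (tderiv_trapezoid adapted_open Nm (xi := coord_diff (c i) m) (W := W i)).
- by move=> j; exact: smooth_coord_diff_adapted.
- by move=> j; exact: smooth_component_adapted.
- by move=> j; exact: coord_diff_diag.
Qed.

Hypothesis prw : pseudo_riemannian (metric w).
Hypothesis tf : torsion_free (conn w).
Variables (Z X T : M -> V).
Hypotheses (sZ : smooth_field Z) (sX : smooth_field X) (sT : smooth_field T).
Hypothesis TY : T m = Y.

(** [Y] is taken as the value at [m] of a smooth field [T] because [conn] is characterised by
    pairing with smooth fields. *)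
Lemma lie_dL_potential : lie Z (fun x => dL potential (x, m) (X x) Y) m =
  lie Z (fun x => w (x, m) (X x) Y) m.
Proof.
have oN := adapted_open; rewrite {1}/lie.
rewrite (eq_tderiv Nm (Z m) oN
  (g := fun x => \sum_(i <- ind N | i \in ind N) rho i m * lie X (L i) x)); last first.
  by move=> x Nx; rewrite /dL/= tderiv_potential.
have sl i : i \in ind N -> smooth_fun N (lie X (L i)).
  by move=> iN; apply: smooth_lie => //; exact: smooth_local_potential_slice.
rewrite (tderiv_sum Nm)//; last first.
  by move=> i iN; apply: smooth_funM => //; [exact: smooth_fun_cst|exact: sl].
rewrite -[RHS]mul1r -(sum_rho_adapted aN Nm) mulr_suml big_seq.
apply: eq_bigr => i iN.
rewrite (tderivM Nm _ (smooth_fun_cst _ _) (sl _ iN)) tderiv_cst mulr0 addr0; congr (_ * _).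
have [ai _ _] := cK i; have Nci := ind_dom aN iN.
have [_ NU _ _] := aN.
have wE (Q : M -> V) x : N x -> w (x, m) (Q x) Y =
    \sum_j lie Q (coord_diff (c i) m j) x * W i j x.
  by move=> Nx; apply: contraction_sum => //; split; [exact: NU|exact: Nci].
have lieE (Q Q' : M -> V) : lie Q (fun x => w (x, m) (Q' x) Y) m =
    lie Q (fun x => \sum_j lie Q' (coord_diff (c i) m j) x * W i j x) m.
  by apply: (eq_tderiv Nm) => // x Nx; exact: wE.
rewrite [RHS](lieE Z X).
have trap := lie_lie_trapezoid fV oN Nm
  (fun j => smooth_coord_diff_adapted j iN) (fun j => smooth_component_adapted j iN)
  sX sZ (coord_diff_diag i).
apply: trap.
(* The premise of [trap], closedness at [m], is rewritten by [metric_conn] as the pairing with [T m]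
   of nabla_Z X - nabla_X Z - [Z, X]. *)
rewrite -(lieE Z X) -(lieE X Z) -(wE (bracket Z X)) // -TY.
have := tf sZ sX m => <-.
have [bg _ _ _] := prw.
have := metric_conn m prw sZ sX sT; have := metric_conn m prw sX sZ sT.
rewrite /lie => <- <-.
have -> : conn w Z X m - conn w X Z m = -1 *: conn w X Z m + conn w Z X m.
  by rewrite scaleN1r addrC.
have := (bg m).2 (T m) (-1) (conn w X Z m) (conn w Z X m).
by rewrite mulN1r addrC => <-.
Qed.

End AtDiagonal.

Lemma conn_potential (Z X : M -> V) : pseudo_riemannian (metric w) ->
  torsion_free (conn w) -> smooth_field Z -> smooth_field X ->
  conn w Z X = conn (dL potential) Z X.
Proof.
(* Both connections are choices from sets, and the sets themselves coincide: their conditions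
   involve only the metric and [lieL] on the diagonal. *)
move=> prw tf sZ sX; apply/funext => m; rewrite /conn; congr xget.
have [N aN Nm] := adapted_nbhd m.
have mE v u : metric (dL potential) m v u = metric w m v u by exact: metric_potential aN Nm _.
have lE T : smooth_field T -> lieL Z w X T (m, m) = lieL Z (dL potential) X T (m, m).
  move=> sT; rewrite /lieL !lie_liftL; congr (_ - _); last by rewrite /eval11 [RHS]mE.
  exact/esym/(lie_dL_potential aN Nm prw tf sZ sX sT erefl).
apply/seteqP; split => v H T sT; have := H T sT; rewrite !mE lE//.
Qed.

End Gluing.
End Construction.

Theorem theorem4p6 (R : realType) (n : nat) (M : manifold 'rV[R]_n)
    (hausdorffM : hausdorff_space M) (paracompactM : paracompact M)
    (connectedM : connected [set: M]) (w : biform11 M) :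
  contrast w -> SMAT (metric w) (conn w) ->
  exists S : biform01 M,
    [/\ local_biform01 S, forall m v, diag01 S m v = 0 & stat_equiv w (dL S)].
Proof.
move=> cw [prw _ tf]; have [[U [[oU dU] lw sw]] _] := cw.
have [I [c [rho [K [cK srho lfK rho1]]]]] := partition_of_unity hausdorffM paracompactM.
have lS := potential_local oU dU lw sw cK srho lfK.
exists (potential w c rho).
have mE : metric w = metric (dL (potential w c rho)).
  apply/funext => m; apply/funext => v; apply/funext => u.
  have [N aN Nm] := adapted_nbhd oU dU cK lfK m.
  by rewrite (metric_potential oU dU lw sw cK srho rho1 _ aN Nm).
split => //; first by move=> m v; exact: potential_diag.
split => //; first by split; [exact: (dL_biform11 (findim_rV R n))|rewrite -mE].
by move=> Z X sZ sX; exact: (conn_potential oU dU lw sw cK srho lfK rho1 prw tf sZ sX).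
Qed.
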